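(* Let $\Omega \subset \mathbb{R}^N$, $N \geq 2$, be a bounded domain with $\partial\Omega$ of class $\mathcal{C}^2$, let $s \in (1/2,1)$, let $f \in L^m(\Omega)$ for some $m > \frac{N}{2s}$ and let $\mu \in L^\infty(\Omega)$. Suppose moreover that $\mu(x) \geq \mu_1 > 0$ in $\Omega$ for some constant $\mu_1$, and that $f^{+} = \max\{f,0\} \not\equiv 0$. Then there exists $\lambda^{\ast\ast} > 0$ such that, for all $\lambda > \lambda^{\ast\ast}$, the Dirichlet problem $$(-\Delta)^s u = \mu(x)\, \mathbb{D}_s^2(u) + \lambda f(x) \ \text{ in } \Omega, \qquad u = 0 \ \text{ in } \mathbb{R}^N \setminus \Omega,$$ has no weak solutions in $W_0^{s,2}(\Omega)$.
   Context: With normalization constants omitted (set equal to $1$), $(-\Delta)^s u(x) = \mathrm{p.v.}\int_{\mathbb{R}^N} \frac{u(x)-u(y)}{|x-y|^{N+2s}}\,dy$ and $\mathbb{D}_s^2(u)(x) = \int_{\mathbb{R}^N} \frac{|u(x)-u(y)|^2}{|x-y|^{N+2s}}\,dy$. Weak solution: $u$ is a weak solution if $u$ and $\mathbb{D}_s^2(u)$ belong to $L^1(\Omega)$, $u \equiv 0$ in $\mathbb{R}^N\setminus\Omega$, and $\int_\Omega u\,(-\Delta)^s\phi\,dx = \int_\Omega \big(\mu(x)\mathbb{D}_s^2(u) + \lambda f(x)\big)\phi\,dx$ for all $\phi \in \mathbb{X}_s$, where $\mathbb{X}_s$ is the set of $\xi \in \mathcal{C}(\mathbb{R}^N)$ with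 $\operatorname{Supp}\xi \subset \overline{\Omega}$ such that $(-\Delta)^s\xi(x)$ exists for all $x \in \Omega$ and $|(-\Delta)^s \xi(x)| \leq C$ on $\Omega$ for some $C>0$. $W_0^{s,p}(\Omega) := \{u \in W^{s,p}(\mathbb{R}^N) : u = 0 \text{ in } \mathbb{R}^N\setminus\Omega\}$, where $W^{s,p}(\mathbb{R}^N)$ is the set of $u\in L^p(\mathbb{R}^N)$ with $\iint_{\mathbb{R}^{2N}}\frac{|u(x)-u(y)|^p}{|x-y|^{N+sp}}\,dx\,dy<\infty$. *)

(* Defs.v *)
From HB Require Import structures.
From mathcomp Require Import all_boot all_order all_algebra.
From mathcomp Require Import all_classical all_reals all_analysis.

Set Implicit Arguments.
Unset Strict Implicit.
Unset Printing Implicit Defensive.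

Import Order.TTheory GRing.Theory Num.Theory.
Import numFieldNormedType.Exports.

Local Open Scope classical_set_scope.
Local Open Scope ring_scope.

(* The measurable sets of 'rV[T]_n are those of the product sigma-algebra (the
   Borel sets when T = R), as for n.-tuple T. *)
Section measurable_rV.
Context {d : measure_display} {T : measurableType d} {n : nat}.

Definition rV_coord (i : 'I_n) (x : 'rV[T]_n) : T := x ord0 i.

Let rV_set0 : g_sigma_preimage rV_coord set0.
Proof. exact: sigma_algebra0. Qed.

Let rV_setC A : g_sigma_preimage rV_coord A -> g_sigma_preimage rV_coord (~` A).
Proof. exact: sigma_algebraC. Qed.

Let rV_bigcup (F : _^nat) : (forall i, g_sigma_preimage rV_coord (F i)) ->
  g_sigma_preimage rV_coord (\bigcup_i (F i)).
Proof. exact: sigma_algebra_bigcup. Qed.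

HB.instance Definition _ := @isMeasurable.Build (measure_tuple_display d)
  'rV[T]_n (g_sigma_preimage rV_coord) rV_set0 rV_setC rV_bigcup.

End measurable_rV.

Lemma measurable_rV_coord d (T : measurableType d) n (i : 'I_n) :
  measurable_fun [set: 'rV[T]_n] (fun x : 'rV[T]_n => x ord0 i).
Proof.
move=> _ Y mY; rewrite setTI; apply: sub_sigma_algebra => /=.
rewrite -bigcup_seq/=; exists i => /=; first by rewrite mem_index_enum.
by exists Y => //; rewrite setTI.
Qed.

Lemma measurable_fun_rVP d1 d2 (T1 : measurableType d1) (T2 : measurableType d2)
    n (f : T1 -> 'rV[T2]_n) :
  measurable_fun [set: T1] f <->
  forall i, measurable_fun [set: T1] (fun x => f x ord0 i).
Proof.
split=> [mf i|mf].
  exact: (measurableT_comp (@measurable_rV_coord _ _ _ i)).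
apply: (@iffRL _ _ (_ : _ <->
  g_sigma_preimage (fun i => @rV_coord _ T2 n i \o f) `<=` measurable)).
  rewrite g_sigma_preimage_comp; split=> [mf' A [/= C preC <-]|prefS].
    exact: mf'.
  by move=> _ A mA; apply: prefS; exists A.
apply: smallest_sub; first exact: sigma_algebra_measurable.
case: n => [|n] in f mf *; first by rewrite big_ord0.
rewrite -bigcup_mkord_ord; apply: bigcup_sub => i Ii.
by move=> A [B mB <-]; exact: mf.
Qed.

Section lebesgue_measure_rV.
Context {R : realType}.

Definition rV_cons (n : nat) (p : measurableTypeR R * 'rV[R]_n) : 'rV[R]_n.+1 :=
  row_mx (const_mx p.1 : 'rV[R]_1) p.2.

Fixpoint lebesgue_rV (n : nat) : set 'rV[R]_n -> \bar R :=
  match n with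
  | 0 => \d_(0 : 'rV[R]_0)
  | n'.+1 => pushforward (@lebesgue_measure R \x @lebesgue_rV n')%E
               (@rV_cons n')
  end.
Arguments lebesgue_rV n _ : clear implicits.

Definition rV_uncons (n : nat) (x : 'rV[R]_n.+1) : measurableTypeR R * 'rV[R]_n :=
  (x ord0 ord0, \row_(j < n) x ord0 (lift ord0 j)).

Lemma rV_consK n : cancel (@rV_cons n) (@rV_uncons n).
Proof.
move=> [a v]; rewrite /rV_cons /rV_uncons /=; congr pair.
  have -> : ord0 = lshift n (ord0 : 'I_1) by exact: val_inj.
  by rewrite (@row_mxEl _ 1 1 n) mxE.
apply/rowP => j; rewrite mxE.
have -> : lift ord0 j = rshift 1 j by exact: val_inj.
by rewrite (@row_mxEr _ 1 1 n).
Qed.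

Lemma measurable_rV_cons n : measurable_fun setT (@rV_cons n).
Proof.
apply/measurable_fun_rVP => i.
case: (unliftP ord0 i) => [j|] ->.
- rewrite (_ : (fun _ => _) = (fun x : 'rV[R]_n => x ord0 j) \o snd).
    by apply: measurableT_comp => //; exact: measurable_rV_coord.
  apply/funext => p /=; rewrite /rV_cons.
  have -> : lift ord0 j = rshift 1 j by exact: val_inj.
  by rewrite (@row_mxEr _ 1 1 n).
- rewrite (_ : (fun _ => _) = fst) //; apply/funext => p /=; rewrite /rV_cons.
  have -> : ord0 = lshift n (ord0 : 'I_1) by exact: val_inj.
  by rewrite (@row_mxEl _ 1 1 n) mxE.
Qed.

Lemma measurable_rV_uncons n : measurable_fun setT (@rV_uncons n).
Proof.
apply: measurable_fun_pair; first exact: measurable_rV_coord.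
apply/measurable_fun_rVP => j.
rewrite (_ : (fun _ => _) = fun x : 'rV[R]_n.+1 => x ord0 (lift ord0 j)).
  exact: measurable_rV_coord.
by apply/funext => x; rewrite mxE.
Qed.

Section cons_measure.
Variables (n : nat) (m : {sigma_finite_measure set 'rV[R]_n -> \bar R}).

Let mu := pushforward (@lebesgue_measure R \x m)%E (@rV_cons n).

Let mu0 : mu set0 = 0%E.
Proof. by rewrite /mu /pushforward preimage_set0 measure0. Qed.

Let mu_ge0 A : (0 <= mu A)%E.
Proof. exact: (measure_ge0 (@lebesgue_measure R \x m)%E). Qed.

Let mcons A : measurable A -> measurable (@rV_cons n @^-1` A).
Proof. by move=> mA; rewrite -[X in measurable X]setTI; exact: measurable_rV_cons. Qed.

Let mu_sigma_additive : semi_sigma_additive mu.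
Proof.
move=> F mF tF mUF; rewrite /mu /pushforward preimage_bigcup.
apply: measure_semi_sigma_additive.
- by move=> k; exact: mcons.
- apply/trivIsetP => /= i j _ _ ij; rewrite -preimage_setI.
  by move/trivIsetP : tF => /(_ _ _ _ _ ij) ->//; rewrite preimage_set0.
- by rewrite -preimage_bigcup; exact: mcons.
Qed.

HB.instance Definition _ :=
  isMeasure.Build _ _ _ mu mu0 mu_ge0 mu_sigma_additive.

Let mu_sigma_finite : sigma_finite setT mu.
Proof.
have /sigma_finiteP[F [TF ndF Foo]] := sigma_finiteT (@lebesgue_measure R).
have /sigma_finiteP[G [TG ndG Goo]] := sigma_finiteT m.
exists (fun k => @rV_uncons n @^-1` (F k `*` G k)).
  rewrite -preimage_bigcup (_ : \bigcup_k _ = setT) ?preimage_setT //.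
  rewrite predeqE => -[x y]; split=> // _.
  have [k _ Fkx] : (\bigcup_k F k) x by rewrite -TF.
  have [l _ Gly] : (\bigcup_k G k) y by rewrite -TG.
  exists (maxn k l) => //; split.
    by move: x Fkx; exact/subsetPset/ndF/leq_maxl.
  by move: y Gly; exact/subsetPset/ndG/leq_maxr.
move=> k; have [mF Fk] := Foo k; have [mG Gk] := Goo k; split.
  rewrite -[X in measurable X]setTI; apply: measurable_rV_uncons => //.
  exact: measurableX.
rewrite /mu /pushforward -comp_preimage (_ : _ \o _ = id); last first.
  by apply/funext => p /=; rewrite rV_consK.
by rewrite preimage_id product_measure1E// lte_mul_pinfty// ge0_fin_numE.
Qed.

HB.instance Definition _ :=
  Measure_isSigmaFinite.Build _ _ _ mu mu_sigma_finite.

Lemma lebesgue_rV_cons : exists m' : {sigma_finite_measure set 'rV[R]_n.+1 -> \bar R},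
  pushforward (@lebesgue_measure R \x m)%E (@rV_cons n) = m'.
Proof. by exists mu. Qed.

End cons_measure.

Lemma lebesgue_rV_spec n :
  exists m : {sigma_finite_measure set 'rV[R]_n -> \bar R}, lebesgue_rV n = m.
Proof.
elim: n => [|n [m mE]] /=; first by exists (\d_(0 : 'rV[R]_0)).
by rewrite mE; exact: lebesgue_rV_cons.
Qed.

Let lebesgue_rV0 n : lebesgue_rV n set0 = 0%E.
Proof. by have [m ->] := lebesgue_rV_spec n; exact: measure0. Qed.

Let lebesgue_rV_ge0 n A : (0 <= lebesgue_rV n A)%E.
Proof. by have [m ->] := lebesgue_rV_spec n; exact: measure_ge0. Qed.

Let lebesgue_rV_sigma_additive n : semi_sigma_additive (lebesgue_rV n).
Proof.
by have [m ->] := lebesgue_rV_spec n; exact: measure_semi_sigma_additive.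
Qed.

HB.instance Definition _ n := isMeasure.Build _ _ _ (lebesgue_rV n)
  (@lebesgue_rV0 n) (@lebesgue_rV_ge0 n) (@lebesgue_rV_sigma_additive n).

Let lebesgue_rV_sigma_finite n : sigma_finite setT (lebesgue_rV n).
Proof. by have [m ->] := lebesgue_rV_spec n; exact: sigma_finiteT. Qed.

HB.instance Definition _ n := Measure_isSigmaFinite.Build _ _ _ (lebesgue_rV n)
  (@lebesgue_rV_sigma_finite n).

End lebesgue_measure_rV.
Arguments lebesgue_rV {R} n _.

Section fractional.
Context {R : realType} {n : nat}.
Implicit Types (Omega : set 'rV[R]_n) (u phi : 'rV[R]_n -> R) (x y : 'rV[R]_n).

Local Notation leb := (@lebesgue_rV R n).

(* `|x| on 'rV[R]_n is the sup norm, so the Euclidean norm is introduced here. *)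
Definition eucl_norm (d : nat) (x : 'rV[R]_d) : R :=
  Num.sqrt (\sum_(i < d) x ord0 i ^+ 2).

Fixpoint class_C (d k : nat) (g : 'rV[R]_d -> R) : Prop :=
  match k with
  | 0 => continuous g
  | k'.+1 => continuous g /\
      forall i : 'I_d, (forall x : 'rV[R]_d, derivable g x (delta_mx ord0 i)) /\
        class_C k' ('D_(delta_mx ord0 i) g)
  end.

(* Near each of its boundary points, Omega is, up to relabelling and reorienting
   the axes, the strict epigraph of a C^2 function of the other coordinates. *)
Definition C2_boundary Omega : Prop :=
  forall x0, (closure Omega `\` Omega°) x0 ->
  exists (i : 'I_n) (b : bool) (g : 'rV[R]_n.-1 -> R) (r : R),
    [/\ class_C 2 g, 0 < r &
      forall x, eucl_norm (x - x0) < r ->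
        (Omega x <-> g (col' i x) < (-1) ^+ b * x ord0 i)].

Definition bounded_C2_domain Omega : Prop :=
  [/\ open Omega, connected Omega, Omega !=set0, bounded_set Omega &
      C2_boundary Omega].

(* An element of an L^p space is represented by a Borel measurable function; all
   pointwise conditions on such functions below are almost everywhere ones.  The
   values of f outside Omega are irrelevant: f \_ Omega vanishes there. *)
Definition Lp_on Omega (p : \bar R) (f : 'rV[R]_n -> R) : Prop :=
  f \_ Omega \in Lfun leb p.

Definition W_sp (s p : R) u : Prop :=
  u \in Lfun leb p%:E /\
  (\int[leb \x leb]_z
     (`|u z.1 - u z.2| `^ p / eucl_norm (z.1 - z.2) `^ (n%:R + s * p))%:E
   < +oo)%E.

Definition W0_sp Omega (s p : R) u : Prop :=
  W_sp s p u /\ {ae leb, forall x, ~ Omega x -> u x = 0}.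

(* In Ds2 and fracLap the normalization constants are taken to be 1.  The kernel
   at y = x is 0 / 0 = 0, on a null set. *)
Definition Ds2 (s : R) u x : \bar R :=
  (\int[leb]_y (`|u x - u y| ^+ 2 /
                eucl_norm (x - y) `^ (n%:R + 2 * s))%:E)%E.

Definition fracLap_kernel (s : R) phi x y : R :=
  (phi x - phi y) / eucl_norm (x - y) `^ (n%:R + 2 * s).

Definition fracLap_trunc (s : R) phi x (eps : R) : R :=
  \int[leb]_(y in [set y | eps <= eucl_norm (x - y)]) fracLap_kernel s phi x y.

Definition fracLap_exists (s : R) phi x : Prop :=
  (forall eps, 0 < eps ->
     leb.-integrable [set y | eps <= eucl_norm (x - y)]
       (EFin \o fracLap_kernel s phi x)) /\
  cvg (fracLap_trunc s phi x eps @[eps --> 0^'+]).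

(* lim returns an arbitrary value when there is no limit, so fracLap is only
   meaningful at points where fracLap_exists holds. *)
Definition fracLap (s : R) phi x : R :=
  lim (fracLap_trunc s phi x eps @[eps --> 0^'+]).

Definition test_space Omega (s : R) phi : Prop :=
  [/\ continuous phi,
      closure [set x | phi x != 0] `<=` closure Omega,
      forall x, Omega x -> fracLap_exists s phi x &
      exists2 C : R, 0 < C & forall x, Omega x -> `|fracLap s phi x| <= C].

Definition weak_solution Omega (s : R) (mu f : 'rV[R]_n -> R) (lambda : R) u :
    Prop :=
  [/\ leb.-integrable Omega (EFin \o u),
      leb.-integrable Omega (Ds2 s u),
      {ae leb, forall x, ~ Omega x -> u x = 0} &
      forall phi, test_space Omega s phi ->
        (\int[leb]_(x in Omega) (u x * fracLap s phi x)%:E =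
         \int[leb]_(x in Omega)
           (((mu x)%:E * Ds2 s u x + (lambda * f x)%:E) * (phi x)%:E))%E].

End fractional.

(* Main.v *)
(* Let phi be a Lipschitz, C^{1,1} function supported in a box inside Omega, and
   test the equation with phi^2.  Symmetrizing the truncated double integrals,
   [2 \int u (-Delta)^s phi^2] is a limit of integrals of
   [(u(x) - u(y)) (phi(x)^2 - phi(y)^2) / |x - y|^{N + 2s}], and Young's inequality
   with weight mu1 bounds it by [2 mu1 \int D_s^2(u) phi^2] plus
   [(2 mu1)^-1 [phi]^2], where [phi]^2 is the squared Gagliardo seminorm.  The
   gradient term is absorbed by mu >= mu1, which leaves
   [lambda \int f phi^2 <= (4 mu1)^-1 [phi]^2] with no dependence on u.  Such a phi
   with [\int f phi^2 > 0] exists because products of one-dimensional ramps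
   approximate the indicator of {f > 0} in L^1(|f| dx). *)
Require Import Defs.
From mathcomp Require Import all_boot all_order all_algebra.
From mathcomp Require Import all_classical all_reals all_analysis.
From mathcomp Require Import measurable_realfun ess_sup_inf unstable ring lra.

Set Implicit Arguments.
Unset Strict Implicit.
Unset Printing Implicit Defensive.

Import Order.TTheory GRing.Theory Num.Theory.
Import numFieldNormedType.Exports.

Local Open Scope classical_set_scope.
Local Open Scope ring_scope.

(** * Integrals of power functions *)

Section power_integrals.
Context {R : realType}.
Local Notation mu := (@lebesgue_measure R).

(** Since [2 * s > 1], a Lipschitz numerator only bounds the kernel by |x - y|^(1 - N - 2s), which
    is not integrable at the diagonal. The double integral carrying the factor u(x) therefore has no
    integrable majorant, and its variables can be exchanged only after truncation at a distance e.
    The C^{1,1} bound allows e to tend to 0 afterwards: second differences bound the truncated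
    operators uniformly in x and e, so that C |u| dominates the outer integrals. The test function
    is a square because phi(x)^2 - phi(y)^2 = (phi(x) - phi(y)) (phi(x) + phi(y)): Young's
    inequality then puts the weights phi(x)^2 and phi(y)^2 on the energy of u and leaves (phi(x) -
    phi(y))^2, with no division by phi. All singular majorants are multiples of min(1, |z|^2) /
    |z|^(N + 2s), integrable because 0 < s < 1. Its integral is bounded without polar coordinates,
    by a product of one-variable profiles. *)

Lemma powR_is_derive (a x : R) : a != 0 -> 0 < x ->
  is_derive x 1 (fun t => a^-1 * t `^ a) (x `^ (a - 1)).
Proof.
move=> a0 x0; have H := is_derive1_powR a x0.
apply: is_derive_eq; rewrite /GRing.scale/= mulrA mulVf ?mul1r//.
Qed.

Lemma powR_continuous (a x : R) : 0 < x -> {for x, continuous (@powR R ^~ a)}.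
Proof.
move=> x0; apply: differentiable_continuous; apply/derivable1_diffP.
by have [] := is_derive1_powR a x0.
Qed.

Lemma integral_powR_itv (a e : R) : 0 < a -> 0 < e < 1 ->
  (\int[mu]_(x in `[e, 1%R]) (x `^ (a - 1))%:E <= (a^-1)%:E)%E.
Proof.
move=> a0 /andP[e0 e1].
have H x : x \in `[e, 1%R] -> 0 < x.
  by rewrite in_itv/= => /andP[+ _]; exact: lt_le_trans.
have cF x : 0 < x -> {for x, continuous (fun t => a^-1 * t `^ a)}.
  move=> x0; apply: differentiable_continuous; apply/derivable1_diffP.
  by have [] := @powR_is_derive a x (lt0r_neq0 a0) x0.
rewrite (@continuous_FTC2 _ _ (fun t => a^-1 * t `^ a))//.
- by rewrite -EFinB lee_fin powR1 mulr1 gerBl mulr_ge0 ?powR_ge0 ?invr_ge0 ?ltW.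
- apply/continuous_within_itvP => //; split.
  + move=> x /subset_itv_oo_cc /H; exact: powR_continuous.
  + by apply: cvg_at_right_filter; exact: powR_continuous.
  + by apply: cvg_at_left_filter; exact: powR_continuous.
- split.
  + move=> x /subset_itv_oo_cc /H x0.
    by have [] := @powR_is_derive a x (lt0r_neq0 a0) x0.
  + by apply: cvg_at_right_filter; exact: cF.
  + by apply: cvg_at_left_filter; exact: cF.
- move=> x /subset_itv_oo_cc /H x0; rewrite derive1E.
  by have [_ ->] := @powR_is_derive a x (lt0r_neq0 a0) x0.
Qed.

Lemma integral_powR_01_lty (a : R) : 0 < a ->
  (\int[mu]_(x in `]0%R, 1%R]) (x `^ (a - 1))%:E < +oo)%E.
Proof.
move=> a0.
(* The offset in [k.+2] keeps the left endpoint strictly below 1, as [integral_powR_itv] requires;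
   the bound [a^-1] obtained there does not depend on [k]. *)
pose F (k : nat) := `[k.+2%:R^-1 : R, 1]%classic.
have -> : `]0%R, 1%R]%classic = \bigcup_k F k.
  apply/seteqP; split => x /=; rewrite in_itv/=.
    move=> /andP[x0 x1]; exists (Num.trunc x^-1) => //; rewrite /F/= in_itv/= x1 andbT.
    rewrite invf_ple ?posrE//.
    apply: ltW; apply: (lt_trans (truncnS_gt _)); by rewrite ltr_nat.
  by move=> [k _]; rewrite /F/= in_itv/= => /andP[+ ->]; rewrite andbT; apply: lt_le_trans.
have nd : nondecreasing_seq F.
  move=> m n mn; rewrite subsetEset => x; rewrite /F/= !in_itv/= => /andP[+ ->].
  rewrite andbT; apply: le_trans; rewrite lef_pV2 ?posrE// ler_nat.
  by rewrite !ltnS.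
have mf i : measurable_fun (F i) (EFin \o (@powR R ^~ (a - 1))).
  by apply/measurable_EFinP; apply: measurable_funTS; exact: measurable_powR.
have f0 i (x : R) : F i x -> (0 <= (x `^ (a - 1))%:E)%E by rewrite lee_fin powR_ge0.
have mF i : measurable (F i) by exact: measurable_itv.
have := @ge0_nondecreasing_set_cvg_integral _ (measurableTypeR R) _ F _ mu nd mF mf f0.
move=> /cvg_lim <-//.
apply: (@le_lt_trans _ _ (a^-1)%:E); last by rewrite ltry.
apply: lime_le.
  apply: ereal_nondecreasing_is_cvgn.
  exact: (@ge0_nondecreasing_set_nondecreasing_integral _ (measurableTypeR R) _ F _ mu nd
    mF mf f0).
apply: nearW => k; apply: integral_powR_itv => //.
by rewrite invr_gt0 ltr0n/= invf_lt1// ltr1n.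
Qed.

Lemma integral_powR_1y_lty (b : R) : 0 < b ->
  (\int[mu]_(x in `[1%R, +oo[) (x `^ (- 1 - b))%:E < +oo)%E.
Proof.
move=> b0.
have nb0 : - b != 0 by rewrite oppr_eq0 lt0r_neq0.
have cF x : 0 < x -> {for x, continuous (fun t => (- b)^-1 * t `^ (- b))}.
  move=> x0; apply: differentiable_continuous; apply/derivable1_diffP.
  by have [] := @powR_is_derive (- b) x nb0 x0.
rewrite (@ge0_continuous_FTC2y _ _ (fun t => (- b)^-1 * t `^ (- b)) _ 0).
- by rewrite -EFinB ltry.
- by move=> x _; exact: powR_ge0.
- apply/continuous_within_itvcyP; split.
    by move=> x; rewrite in_itv/= andbT => x1; apply: powR_continuous; lra.
  by apply: cvg_at_right_filter; exact: powR_continuous.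
- rewrite -(mulr0 (- b)^-1); apply: cvgMr.
  apply/cvgrPdist_le => e e0; near=> x.
  have M0 : 0 < e `^ (- b^-1) by exact: powR_gt0.
  have xM : e `^ (- b^-1) <= x by near: x; exact: nbhs_pinfty_ge.
  rewrite sub0r normrN ger0_norm ?powR_ge0// powRN.
  have x0 : 0 < x := lt_le_trans M0 xM.
  rewrite -[leRHS]invrK lef_pV2 ?posrE ?invr_gt0 ?powR_gt0//.
  have -> : e^-1 = (e `^ (- b^-1)) `^ b.
    by rewrite -powRrM mulNr mulVf ?lt0r_neq0// powR_inv1// ltW.
  by apply: ge0_ler_powR => //; rewrite ?nnegrE ltW.
- move=> x x1.
  by have [] := @powR_is_derive (- b) x nb0 (lt_trans ltr01 x1).
- by apply: cvg_at_right_filter; exact: cF.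
- move=> x; rewrite in_itv/= andbT => x1; rewrite derive1E.
  have [_ ->] := @powR_is_derive (- b) x nb0 (lt_trans ltr01 x1).
  by congr (_ `^ _); lra.
Unshelve. all: by end_near. Qed.

(* A product of copies of this profile dominates the singular kernel of the
   fractional Laplacian. *)
Definition kprofile (a b t : R) : R :=
  Num.min (`|t| `^ (a - 1)) (`|t| `^ (- 1 - b)).

Lemma kprofile_ge0 a b t : 0 <= kprofile a b t.
Proof. by rewrite /kprofile le_min !powR_ge0. Qed.

Lemma measurable_kprofile a b : measurable_fun setT (kprofile a b).
Proof.
by apply: measurable_minr; apply: (measurableT_comp (measurable_powR _)).
Qed.

(** Near 0 the exponent [a - 1] exceeds -1, and near infinity [- 1 - b] is below -1; each branch of
    the minimum is used where it is integrable. Evenness reduces the negative half-line to the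
    positive one. *)
Lemma integral_kprofile_lty a b : 0 < a -> 0 < b ->
  (\int[mu]_t (kprofile a b t)%:E < +oo)%E.
Proof.
move=> a0 b0.
have mk : measurable_fun setT (fun t => (kprofile a b t)%:E).
  by apply/measurable_EFinP; exact: measurable_kprofile.
have k0 (t : R) : (0 <= (kprofile a b t)%:E)%E by rewrite lee_fin kprofile_ge0.
have kpos : (\int[mu]_(t in `]0%R, +oo[) (kprofile a b t)%:E < +oo)%E.
  have -> : `]0%R, +oo[%classic = `]0%R, 1%R] `|` `]1%R, +oo[ :> set R.
    apply/seteqP; split => x /=; rewrite !in_itv/= !andbT.
      by move=> ->; case: (leP x 1) => _; [left|right].
    by move=> [/andP[]//|]; exact: lt_trans.
  rewrite ge0_integral_setU//=; last 2 first.
  - exact: measurable_funTS.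
  - apply/disj_setPLR => x /=; rewrite !in_itv/= andbT => /andP[_ x1].
    by apply/negP; rewrite -leNgt.
  apply: lte_add_pinfty.
    apply: le_lt_trans (integral_powR_01_lty a0).
    apply: ge0_le_integral => //.
    - exact: measurable_funTS.
    - by apply/measurable_EFinP; apply: measurable_funTS; exact: measurable_powR.
    - move=> x /=; rewrite in_itv/= => /andP[x0 _].
      by rewrite lee_fin /kprofile (ger0_norm (ltW x0)) ge_min lexx.
  apply: le_lt_trans (integral_powR_1y_lty b0).
  rewrite -[X in (_ <= X)%E]integral_itv_obnd_cbnd; last first.
    by apply/measurable_EFinP; apply: measurable_funTS; exact: measurable_powR.
  apply: ge0_le_integral => //.
  - exact: measurable_funTS.
  - by apply/measurable_EFinP; apply: measurable_funTS; exact: measurable_powR.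
  - move=> x /=; rewrite in_itv/= andbT => x0.
    have x1 : 0 <= x := ltW (lt_trans ltr01 x0).
    by rewrite lee_fin /kprofile (ger0_norm x1) ge_min lexx orbT.
have kpos' : (\int[mu]_(t in `[0%R, +oo[) (kprofile a b t)%:E < +oo)%E.
  by rewrite -integral_itv_obnd_cbnd//; exact: measurable_funTS.
have kneg : (\int[mu]_(t in `]-oo, 0%R]) (kprofile a b t)%:E < +oo)%E.
  have kN (t : R) : kprofile a b (- t) = kprofile a b t by rewrite /kprofile normrN.
  have := @ge0_integration_by_substitution0 R (fun t => (kprofile a b t)%:E) mk k0.
  by under [X in _ = X -> _]eq_integral do rewrite kN; move=> <-.
have -> : [set: measurableTypeR R] = `]-oo, 0%R] `|` `]0%R, +oo[.
  apply/seteqP; split => x //= _; rewrite !in_itv/= !andbT.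
  by case: (leP x 0) => _; [left|right].
rewrite ge0_integral_setU//=; last 2 first.
- exact: measurable_funTS.
- apply/disj_setPLR => x /=; rewrite !in_itv/= andbT => x1.
  by apply/negP; rewrite -leNgt.
exact: lte_add_pinfty.
Qed.

End power_integrals.

(** * Lebesgue measure on row vectors *)

Section lebesgue_rV_theory.
Context {R : realType}.
Local Notation mu := (@lebesgue_measure R).
Local Notation leb n := (@lebesgue_rV R n).

Lemma ge0_integral_lebesgue_rVS n (f : 'rV[R]_n.+1 -> \bar R) :
  measurable_fun setT f -> (forall x, 0 <= f x)%E ->
  (\int[leb n.+1]_x f x = \int[mu]_t \int[leb n]_v f (rV_cons (t, v)))%E.
Proof.
move=> mf f0.
rewrite (@eq_measure_integral _ _ _ _
  (pushforward (mu \x leb n)%E (@rV_cons R n)))//.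
rewrite (ge0_integral_pushforward (@measurable_rV_cons R n))//.
rewrite preimage_setT (fubini_tonelli1 (f \o @rV_cons R n))//.
  by apply: (measurableT_comp mf); exact: measurable_rV_cons.
by move=> x; exact: f0.
Qed.

Lemma rV_cons0 n (p : R * 'rV[R]_n) : rV_cons p ord0 ord0 = p.1.
Proof.
rewrite /rV_cons (_ : ord0 = lshift n (ord0 : 'I_1)); last exact: val_inj.
by rewrite (@row_mxEl _ 1 1 n) mxE.
Qed.

Lemma rV_consS n (p : R * 'rV[R]_n) j : rV_cons p ord0 (lift ord0 j) = p.2 ord0 j.
Proof.
rewrite /rV_cons (_ : lift ord0 j = rshift 1 j); last exact: val_inj.
by rewrite (@row_mxEr _ 1 1 n).
Qed.

Lemma ge0_integral_prod_coord n (w : R -> R) :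
  measurable_fun setT w -> (forall t, 0 <= w t) ->
  (\int[leb n]_z (\prod_(i < n) w (z ord0 i))%:E =
   (\int[mu]_t (w t)%:E) ^+ n)%E.
Proof.
move=> mw w0.
have mprod k : measurable_fun setT (fun z : 'rV[R]_k => \prod_(i < k) w (z ord0 i)).
  apply: measurable_prod => i _; apply: (measurableT_comp mw).
  exact: measurable_rV_coord.
have mprodE k : measurable_fun setT
    (fun z : 'rV[R]_k => (\prod_(i < k) w (z ord0 i))%:E).
  by apply/measurable_EFinP; exact: mprod.
have mwE : measurable_fun setT (fun t => (w t)%:E) by exact/measurable_EFinP.
have w0E t : (0 <= (w t)%:E)%E by rewrite lee_fin.
have prod0 k (z : 'rV[R]_k) : 0 <= \prod_(i < k) w (z ord0 i) by exact: prodr_ge0.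
elim: n => [|n IH].
  rewrite /= integral_dirac//=; last exact: (mprodE 0%N).
  by rewrite diracE in_setT mul1e big_ord0.
rewrite ge0_integral_lebesgue_rVS//; last by move=> z; rewrite lee_fin prod0.
transitivity (\int[mu]_t ((w t)%:E * (\int[mu]_t (w t)%:E) ^+ n))%E.
  apply: eq_integral => t _; rewrite -IH -ge0_integralZl//.
  - apply: eq_integral => v _; rewrite big_ord_recl rV_cons0 -EFinM.
    by under eq_bigr do rewrite rV_consS.
  - exact: mprodE.
  - by move=> v _; rewrite lee_fin prod0.
rewrite ge0_integralZr//; first by rewrite expeS.
by rewrite expe_ge0// integral_ge0.
Qed.

Lemma measurable_preimage d d' (T : measurableType d) (U : measurableType d')
  (f : T -> U) B : measurable_fun setT f -> measurable B -> measurable (f @^-1` B).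
Proof. by move=> mf mB; rewrite -[X in measurable X]setTI; exact: mf. Qed.

Lemma lebesgue_rVS_preimage n (A : set 'rV[R]_n.+1) (B : set R) (C : set 'rV[R]_n) :
  measurable B -> measurable C -> @rV_cons R n @^-1` A = B `*` C ->
  leb n.+1 A = (mu B * leb n C)%E.
Proof. by move=> mB mC E; rewrite /= /pushforward E product_measure1E. Qed.

(** These are the sets where the product bound on the kernel may fail: a negative power of 0 is 0 by
    convention, so a product of profiles vanishes there instead of being infinite. *)
Lemma lebesgue_rV_hyperplane n (i : 'I_n) : leb n [set z | z ord0 i = 0] = 0%E.
Proof.
elim: n => [|n IH] in i *; first by case: i.
have [j|] := unliftP ord0 i => ->.
  have mC : measurable [set z : 'rV[R]_n | z ord0 j = 0].
    exact (measurable_preimage (@measurable_rV_coord _ (measurableTypeR R) n j)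
      (measurable_set1 (0 : R))).
  rewrite (@lebesgue_rVS_preimage _ _ setT [set z | z ord0 j = 0])//.
    by rewrite IH mule0.
  by apply/seteqP; split => -[t v] /=; rewrite rV_consS//= => -[].
rewrite (@lebesgue_rVS_preimage _ _ [set 0] setT)//.
  by rewrite lebesgue_measure_set1 mul0e.
by apply/seteqP; split => -[t v] /=; rewrite rV_cons0//= => -[].
Qed.

(** The map y -> c - y serves two purposes: with c = x it is the change of variable z = x - y, and
    with c = x + x it is the symmetry about x. *)
Lemma measurable_reflect n (c : 'rV[R]_n) : 
  measurable_fun setT (fun y : 'rV[R]_n => c - y).
Proof.
apply/measurable_fun_rVP => i; under eq_fun do rewrite !mxE.
apply: measurable_funB => //; exact: measurable_rV_coord.
Qed.

Lemma lebesgue_measure_reflect (c : R) (A : set (measurableTypeR R)) : measurable A ->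
  pushforward mu (fun t : measurableTypeR R => c - t : measurableTypeR R) A = mu A.
Proof.
have mT : measurable_fun setT (fun t : measurableTypeR R => c - t : measurableTypeR R).
  exact: measurable_funB.
move=> mA; apply/esym; apply: (@lebesgue_measure_unique _
  (measure_function_pushforward__canonical__measure_function_Measure mu mT)) => //=.
move=> _ [[a b]] _ <-.
(* Reflection turns the generating interval []a, b]] into one closed on the other side, of the same
   length. *)
rewrite /pushforward (_ : _ @^-1` _ = `[c - b, c - a[%classic); last first.
  by apply/seteqP; split => x /=; rewrite !in_itv/= => /andP[? ?]; apply/andP; split; lra.
rewrite !lebesgue_measure_itv/= !lte_fin ltrD2l ltrN2; case: ifP => // _.
by congr (_%:E); lra.
Qed.

(** By induction on the dimension: the first coordinate is sliced off, the induction hypothesis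
    reflects each slice, and the one-dimensional case reflects the slicing variable. *)
Lemma lebesgue_rV_reflect n (c : 'rV[R]_n) A : measurable A ->
  leb n ((fun y => c - y) @^-1` A) = leb n A.
Proof.
elim: n => [|n IH] in c A * => mA.
  by congr (_ _); apply/seteqP; split => x /=; rewrite !(thinmx0 (_ : 'rV_0)).
have mT : measurable ((fun y => c - y) @^-1` A).
  by apply: measurable_preimage => //; exact: measurable_reflect.
pose c' : 'rV[R]_n := \row_j c ord0 (lift ord0 j).
pose G t := leb n (xsection (@rV_cons R n @^-1` A) t).
have mA' : measurable (@rV_cons R n @^-1` A).
  by apply: measurable_preimage => //; exact: measurable_rV_cons.
have mG : measurable_fun setT G by exact: measurable_fun_xsection.
have consB t v : c - rV_cons (t, v) = rV_cons (c ord0 ord0 - t, c' - v).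
  apply/rowP => i; rewrite 2!mxE.
  by have [j|] := unliftP ord0 i => ->; rewrite ?rV_cons0 ?rV_consS //= !mxE.
transitivity (\int[mu]_t G (c ord0 ord0 - t)%R)%E.
  apply: eq_integral => t _; rewrite /G -(IH c'); last exact: measurable_xsection.
  congr (leb n _); rewrite /xsection; apply/seteqP; split => v /=; rewrite !inE/=;
    by rewrite -consB.
rewrite -[RHS]/(\int[mu]_t G t)%E.
have mR : measurable_fun setT
    (fun t : measurableTypeR R => c ord0 ord0 - t : measurableTypeR R).
  exact: measurable_funB.
rewrite -[LHS](@ge0_integral_pushforward _ _ _ (measurableTypeR R) _ _ mR mu setT G)//.
exact: (@eq_measure_integral _ (measurableTypeR R) R setT mu
  (measure_function_pushforward__canonical__measure_function_Measure mu mR) G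
  (fun B mB _ => lebesgue_measure_reflect (c ord0 ord0) mB)).
Qed.

Lemma integral_reflect n (c : 'rV[R]_n) (f : 'rV[R]_n -> \bar R) :
  measurable_fun setT f -> (\int[leb n]_y f (c - y)%R = \int[leb n]_y f y)%E.
Proof.
wlog f0 : f / forall x, (0 <= f x)%E => [hw mf|mf].
  have mp := measurable_funepos mf; have mn := measurable_funeneg mf.
  rewrite integralE [RHS]integralE.
  rewrite -(hw f^\+%E (funepos_ge0 f) mp) -(hw f^\-%E (funeneg_ge0 f) mn).
  congr (_ - _)%E; apply: eq_integral => x _; first by rewrite !funeposE.
  by rewrite !funenegE.
rewrite -[LHS](@ge0_integral_pushforward _ _ _ _ _ _ (measurable_reflect c) (leb n) setT f)//.
exact: (@eq_measure_integral _ _ R setT (leb n)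
  (measure_function_pushforward__canonical__measure_function_Measure (leb n)
    (measurable_reflect c)) f (fun B mB _ => lebesgue_rV_reflect c mB)).
Qed.

End lebesgue_rV_theory.

(** * The Euclidean norm and the singular kernel *)

Section eucl_norm_theory.
Context {R : realType}.
Local Notation mu := (@lebesgue_measure R).
Local Notation leb n := (@lebesgue_rV R n).

Lemma eucl_norm_ge0 n (x : 'rV[R]_n) : 0 <= eucl_norm x.
Proof. exact: sqrtr_ge0. Qed.

Lemma eucl_normN n (x : 'rV[R]_n) : eucl_norm (- x) = eucl_norm x.
Proof. by rewrite /eucl_norm; under eq_bigr do rewrite mxE sqrrN. Qed.

Lemma eucl_norm_distC n (x y : 'rV[R]_n) : eucl_norm (x - y) = eucl_norm (y - x).
Proof. by rewrite -eucl_normN opprB. Qed.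

Lemma ler_coord_eucl_norm n (x : 'rV[R]_n) i : `|x ord0 i| <= eucl_norm x.
Proof.
rewrite -sqrtr_sqr /eucl_norm ler_sqrt ?sumr_ge0// => [|j _]; last exact: sqr_ge0.
by rewrite (bigD1 i)//= lerDl sumr_ge0// => j _; exact: sqr_ge0.
Qed.

Lemma ler_coord_norm n (x : 'rV[R]_n) i : `|x ord0 i| <= `|x|.
Proof.
rewrite [leRHS]/Num.norm/= mx_normrE.
exact: (le_bigmax _ (fun ij => `|x ij.1 ij.2|) (ord0, i)).
Qed.

Lemma eucl_norm_le_norm n (x : 'rV[R]_n) : eucl_norm x <= n%:R * `|x|.
Proof.
rewrite -[leRHS]ger0_norm ?mulr_ge0// -sqrtr_sqr /eucl_norm ler_sqrt ?sqr_ge0//.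
apply: (@le_trans _ _ (\sum_(i < n) `|x| ^+ 2)).
  by apply: ler_sum => i _; rewrite -real_normK ?num_real// lerXn2r ?nnegrE// ler_coord_norm.
rewrite sumr_const card_ord exprMn -[leLHS]mulr_natl; apply: ler_wpM2r; first exact: sqr_ge0.
by rewrite -natrX ler_nat; case: (n) => // k; rewrite leq_pmulr.
Qed.

Lemma eucl_norm_gt0 n (x : 'rV[R]_n) : x != 0 -> 0 < eucl_norm x.
Proof.
move=> x0; rewrite lt_neqAle eucl_norm_ge0 andbT eq_sym.
apply: contra x0 => /eqP e; apply/eqP/rowP => i; rewrite mxE; apply/eqP.
by rewrite -normr_le0 -e ler_coord_eucl_norm.
Qed.

Lemma measurable_eucl_norm n : measurable_fun setT (@eucl_norm R n).
Proof.
have sumsq_ge0 (x : 'rV[R]_n) : 0 <= \sum_(i < n) x ord0 i ^+ 2.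
  by apply: sumr_ge0 => i _; exact: sqr_ge0.
rewrite /eucl_norm; under eq_fun do rewrite -powR12_sqrt//.
apply: (measurableT_comp (measurable_powR _)).
by apply: measurable_sum => i; apply: measurable_funX; exact: measurable_rV_coord.
Qed.

Lemma kprofile_le (a b t r : R) : a <= 1 -> 0 <= b -> t != 0 -> `|t| <= r ->
  kprofile a b r <= kprofile a b t.
Proof.
move=> a1 b0 t0 tr.
have tp : 0 < `|t| by rewrite normr_gt0.
have r0 : 0 < r by exact: lt_le_trans tr.
have H c : c <= 0 -> r `^ c <= `|t| `^ c.
  move=> c0; rewrite -[c]opprK !(powRN _ (- c)) lef_pV2 ?posrE ?powR_gt0//.
  by apply: ge0_ler_powR => //; rewrite ?oppr_ge0// nnegrE ?normr_ge0// ltW.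
rewrite /kprofile (gtr0_norm r0) le_min !ge_min !H ?orbT//; lra.
Qed.

(** The exponents are chosen so that, with r = |z|, the left side is exactly the n-th power of
    [kprofile a b r]: n (a - 1) = 2 - n - 2s and n (- 1 - b) = - n - 2s. The profile decreases in
    the modulus of its argument, and each coordinate is at most r in modulus. *)
Lemma levy_kernel_le_prod n (s : R) (z : 'rV[R]_n) : (2 <= n)%N -> 1 / 2 < s < 1 ->
  (forall i, z ord0 i != 0) ->
  Num.min 1 (eucl_norm z ^+ 2) / eucl_norm z `^ (n%:R + 2 * s) <=
  \prod_(i < n) kprofile ((2 - 2 * s) / n%:R) (2 * s / n%:R) (z ord0 i).
Proof.
move=> n2 /andP[s1 s2] z0.
have n0 : n%:R != 0 :> R by rewrite pnatr_eq0; case: n n2 {z z0}.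
have np : 0 < n%:R :> R by rewrite lt0r n0 ler0n.
have n1 : 1 <= n%:R :> R by rewrite ler1n ltnW.
set a := (2 - 2 * s) / n%:R; set b := 2 * s / n%:R.
set r := eucl_norm z.
have r0 : 0 < r.
  apply: eucl_norm_gt0; case: n n2 z z0 {np n1 n0 a b r} => // n _ z /(_ ord0).
  by apply: contraNneq => ->; rewrite mxE.
have -> : Num.min 1 (r ^+ 2) / r `^ (n%:R + 2 * s) = \prod_(i < n) kprofile a b r.
  rewrite prodr_const card_ord /kprofile gtr0_norm//.
  have E c : (r `^ c) ^+ n = r `^ (c * n%:R).
    by rewrite powRrM powR_mulrn// powR_ge0.
  have -> : Num.min (r `^ (a - 1)) (r `^ (-1 - b)) ^+ n =
            Num.min (r `^ (a - 1) ^+ n) (r `^ (-1 - b) ^+ n).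
    rewrite !minEle; case: leP => h.
      by rewrite lerXn2r ?nnegrE ?powR_ge0.
    by rewrite lt_geF// ltrXn2r ?powR_ge0// -lt0n (ltn_trans _ n2).
  rewrite !E minr_pMl ?invr_ge0 ?powR_ge0// mul1r minC; congr (Num.min _ _).
    rewrite -powR_mulrn ?ltW// -powRB; last by rewrite (gt_eqF r0) implybT.
    by congr (_ `^ _); rewrite /a; field.
  by rewrite -powRN; congr (_ `^ _); rewrite /b; field.
apply: ler_prod => i _; rewrite kprofile_ge0/=; apply: kprofile_le => //.
- by rewrite /a ler_pdivrMr// mul1r; apply: le_trans n1; lra.
- by rewrite /b divr_ge0 ?ltW//; lra.
- exact: ler_coord_eucl_norm.
Qed.

Lemma measurable_levy_kernel n (s : R) : measurable_fun setT (fun z : 'rV[R]_n =>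
  Num.min 1 (eucl_norm z ^+ 2) / eucl_norm z `^ (n%:R + 2 * s)).
Proof.
apply: measurable_funM.
  apply: measurable_minr => //; apply: measurable_funX; exact: measurable_eucl_norm.
under eq_fun do rewrite -powRN.
by apply: (measurableT_comp (measurable_powR _)); exact: measurable_eucl_norm.
Qed.

Lemma integral_levy_kernel_lty n (s : R) : (2 <= n)%N -> 1 / 2 < s < 1 ->
  (\int[leb n]_z (Num.min 1 (eucl_norm z ^+ 2) /
     eucl_norm z `^ (n%:R + 2 * s))%:E < +oo)%E.
Proof.
move=> n2 /[dup] s12 /andP[s1 s2].
have np : 0 < n%:R :> R by rewrite ltr0n (leq_trans _ n2).
set a := (2 - 2 * s) / n%:R; set b := 2 * s / n%:R.
apply: (@le_lt_trans _ _ (\int[leb n]_z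
    (\prod_(i < n) kprofile a b (z ord0 i))%:E)%E).
  apply: ae_ge0_le_integral => //.
  - move=> z _; rewrite lee_fin divr_ge0 ?powR_ge0// le_min ler01 sqr_ge0//.
  - by apply/measurable_EFinP; exact: measurable_levy_kernel.
  - by move=> z _; rewrite lee_fin prodr_ge0// => i _; exact: kprofile_ge0.
  - apply/measurable_EFinP; apply: measurable_prod => i _.
    apply: (measurableT_comp (measurable_kprofile a b)); exact: measurable_rV_coord.
  - have : {ae leb n, forall z : 'rV[R]_n, forall i : 'I_n, z ord0 i != 0}.
      apply: filter_forall => i; exists [set z : 'rV[R]_n | z ord0 i = 0]; split.
      + exact (measurable_preimage (@measurable_rV_coord _ (measurableTypeR R) n i)
          (measurable_set1 (0 : R))).
      + exact: lebesgue_rV_hyperplane.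
      + by move=> z /= /negP; rewrite negbK => /eqP.
    by apply: filterS => z z0 _; rewrite lee_fin; exact: levy_kernel_le_prod.
rewrite ge0_integral_prod_coord; last 2 first.
- exact: measurable_kprofile.
- exact: kprofile_ge0.
have a0 : 0 < a by rewrite divr_gt0//; lra.
have b0 : 0 < b by rewrite divr_gt0//; lra.
have I0 : (0 <= \int[mu]_t (kprofile a b t)%:E)%E.
  by apply: integral_ge0 => t _; rewrite lee_fin kprofile_ge0.
have Ifin : (\int[mu]_t (kprofile a b t)%:E \is a fin_num)%E.
  by rewrite ge0_fin_numE// integral_kprofile_lty.
by rewrite -(fineK Ifin) -EFin_expe ltry.
Qed.

End eucl_norm_theory.

(** * Functions of class C^{1,1} *)

Section ramp.
Context {R : realType}.
Implicit Types t h : R.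

(** The squared positive part is the simplest C^{1,1} function that is not C^2; combinations of its
    translates give splines such as [ramp], whose second derivative is 4, then -4. *)
Definition sqpos t : R := Num.max 0 t ^+ 2.

Lemma sqpos_second_diff t h :
  `|sqpos (t + h) + sqpos (t - h) - 2 * sqpos t| <= 2 * h ^+ 2.
Proof.
rewrite /sqpos ler_norml.
by case: (leP 0 (t + h)); case: (leP 0 (t - h)); case: (leP 0 t) => *; nra.
Qed.

(* A C^{1,1} step from 0 to 1, quadratic on [0, 1/2] and on [1/2, 1]. *)
Definition ramp t : R := 2 * sqpos t - 4 * sqpos (t - 1 / 2) + 2 * sqpos (t - 1).

Lemma ramp_cases t : [\/ t <= 0 /\ ramp t = 0, 0 <= t <= 1 / 2 /\ ramp t = 2 * t ^+ 2,
  1 / 2 <= t <= 1 /\ ramp t = 1 - 2 * (1 - t) ^+ 2 | 1 <= t /\ ramp t = 1].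
Proof.
rewrite /ramp /sqpos.
case: (leP 0 t) => t0; last by constructor 1; rewrite !max_l; [nra|lra..].
case: (leP t (1 / 2)) => t1.
  by constructor 2; rewrite ?t0 !max_l ?max_r; [nra|lra..].
case: (leP t 1) => t2.
  by constructor 3; rewrite (ltW t1) (@max_l _ _ 0 (t - 1)) ?max_r; [nra|lra..].
by constructor 4; rewrite !max_r; [nra|lra..].
Qed.

Lemma ramp_itv t : 0 <= ramp t <= 1.
Proof. by case: (ramp_cases t) => -[? ->]; nra. Qed.

Lemma ramp_le0 t : t <= 0 -> ramp t = 0.
Proof. by move=> t0; case: (ramp_cases t) => -[? ->]; nra. Qed.

Lemma ramp_ge1 t : 1 <= t -> ramp t = 1.
Proof. by move=> t0; case: (ramp_cases t) => -[? ->]; nra. Qed.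

Lemma ramp_gt0 t : 0 < t -> 0 < ramp t.
Proof. by move=> t0; case: (ramp_cases t) => -[? ->]; nra. Qed.

(** The slope is in fact at most 2; the constant is taken equal to that of [ramp_second_diff]. *)
Lemma ramp_lipschitz t h : `|ramp (t + h) - ramp t| <= 16 * `|h|.
Proof.
wlog h0 : t h / 0 <= h => [hw|].
  have [|/ltW h0] := leP 0 h; first exact: hw.
  by have := hw (t + h) (- h); rewrite addrK normrN distrC oppr_ge0; apply.
rewrite (ger0_norm h0) ler_norml.
by case: (ramp_cases t) => -[? ->]; case: (ramp_cases (t + h)) => -[? ->]; nra.
Qed.

(** The coefficients 2, 4 and 2 of [ramp] add up to 8, and each second difference of [sqpos] costs
    at most 2 h^2: hence 16. *)
Lemma ramp_second_diff t h :
  `|ramp (t + h) + ramp (t - h) - 2 * ramp t| <= 16 * h ^+ 2.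
Proof.
have := sqpos_second_diff t h; have := sqpos_second_diff (t - 1 / 2) h.
have := sqpos_second_diff (t - 1) h; rewrite /ramp.
rewrite !(addrAC t h) !(addrAC t (- h)) !ler_norml; lra.
Qed.

Lemma measurable_ramp : measurable_fun setT ramp.
Proof.
have m c : measurable_fun setT (fun t => sqpos (t - c)).
  by apply: measurable_funX; apply: measurable_maxr => //; exact: measurable_funB.
have m0 : measurable_fun setT sqpos.
  by apply: measurable_funX; exact: measurable_maxr.
apply: measurable_funD; first apply: measurable_funB; exact: measurable_funM.
Qed.

End ramp.

Section c11.
Context {R : realType} {n : nat}.
Implicit Types (phi psi : 'rV[R]_n -> R).

(* Membership in C^{1,1}, through difference quotients instead of derivatives. *)
Definition c11 phi : Prop :=
  [/\ measurable_fun setT phi, forall x, 0 <= phi x <= 1 &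
  exists2 L : R, 0 <= L & forall x h,
    `|phi (x + h) - phi x| <= L * eucl_norm h /\
    `|phi (x + h) + phi (x - h) - 2 * phi x| <= L * eucl_norm h ^+ 2].

Lemma c11_cst (c : R) : 0 <= c <= 1 -> c11 (cst c).
Proof.
move=> c01; split => //; exists 0 => // x h; rewrite !mul0r /cst.
by split; rewrite normr_le0; apply/eqP; ring.
Qed.

Lemma c11_compl phi : c11 phi -> c11 (fun x => 1 - phi x).
Proof.
move=> [mphi phi01 [L L0 phiL]]; split => //.
- exact: measurable_funB.
- by move=> x; have := phi01 x; lra.
- exists L => // x h; have [l1 l2] := phiL x h; split.
    by rewrite -normrN (_ : - (_ - _ - _) = phi (x + h) - phi x)//; ring.
  by rewrite -normrN (_ : - (_ - 2 * _) = phi (x + h) + phi (x - h) - 2 * phi x)//; ring.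
Qed.

(** Discrete product rule: the second difference of a product consists of the two second
    differences, each multiplied by a value in [0, 1], and of two products of first differences, at
    h and at -h. The latter are of order |h|^2 and account for [2 * L * M]. *)
Lemma c11M phi psi : c11 phi -> c11 psi -> c11 (fun x => phi x * psi x).
Proof.
move=> [mphi phi01 [L L0 phiL]] [mpsi psi01 [M M0 psiM]]; split => //.
- exact: measurable_funM.
- by move=> x; have := phi01 x; have := psi01 x; nra.
exists (L + M + 2 * L * M) => [|x h]; first by nra.
have [l1 l2] := phiL x h; have [m1 m2] := psiM x h.
have [l1' _] := phiL x (- h); have [m1' _] := psiM x (- h).
move: l1' m1'; rewrite eucl_normN.
have := phi01 x; have := psi01 x; have := phi01 (x + h); have := psi01 (x + h).
have := eucl_norm_ge0 h; move: l1 l2 m1 m2.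
move: (eucl_norm h) => r.
move: (phi x) (phi (x + h)) (phi (x - h)) => p p1 p2.
move: (psi x) (psi (x + h)) (psi (x - h)) => q q1 q2.
move=> l1 l2 m1 m2 r0 q101 p101 q01 p01 l1' m1'; split.
  have -> : p1 * q1 - p * q = (p1 - p) * q1 + p * (q1 - q) by ring.
  apply: le_trans (ler_normD _ _) _; rewrite !normrM.
  have : `|p1 - p| * `|q1| <= L * r * 1 by rewrite ler_pM// ler_norml; lra.
  have : `|p| * `|q1 - q| <= 1 * (M * r) by rewrite ler_pM// ler_norml; lra.
  have := mulr_ge0 (mulr_ge0 L0 M0) r0; lra.
have -> : p1 * q1 + p2 * q2 - 2 * (p * q) = (p1 + p2 - 2 * p) * q + p * (q1 + q2 - 2 * q)
  + (p1 - p) * (q1 - q) + (p2 - p) * (q2 - q) by ring.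
have tri (a b c d : R) : `|a + b + c + d| <= `|a| + `|b| + `|c| + `|d|.
  by do 3 (rewrite (le_trans (ler_normD _ _))// lerD2r).
apply: le_trans (tri _ _ _ _) _; rewrite !normrM.
have : `|p1 + p2 - 2 * p| * `|q| <= L * r ^+ 2 * 1 by rewrite ler_pM// ler_norml; lra.
have : `|p| * `|q1 + q2 - 2 * q| <= 1 * (M * r ^+ 2) by rewrite ler_pM// ler_norml; lra.
have : `|p1 - p| * `|q1 - q| <= (L * r) * (M * r) by rewrite ler_pM.
have : `|p2 - p| * `|q2 - q| <= (L * r) * (M * r) by rewrite ler_pM.
lra.
Qed.

Lemma c11_prod (I : Type) (s : seq I) (F : I -> 'rV[R]_n -> R) :
  (forall i, c11 (F i)) -> c11 (fun x => \prod_(i <- s) F i x).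
Proof.
move=> cF; elim: s => [|i s IH].
  by under eq_fun do rewrite big_nil; apply: c11_cst; lra.
by under eq_fun do rewrite big_cons; exact: c11M.
Qed.

Lemma c11_ramp_coord (i : 'I_n) (k c : R) : c11 (fun x => ramp (k * x ord0 i + c)).
Proof.
split.
- apply: (measurableT_comp measurable_ramp); apply: measurable_funD => //.
  by apply: measurable_funM => //; exact: measurable_rV_coord.
- by move=> x; exact: ramp_itv.
exists (16 * `|k| + 16 * k ^+ 2) => [|x h].
  by apply: addr_ge0; rewrite mulr_ge0 ?sqr_ge0.
have -> : k * (x + h) ord0 i + c = k * x ord0 i + c + k * h ord0 i by rewrite mxE; ring.
have -> : k * (x - h) ord0 i + c = k * x ord0 i + c - k * h ord0 i by rewrite !mxE; ring.
have hr := ler_coord_eucl_norm h i.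
have hr2 : h ord0 i ^+ 2 <= eucl_norm h ^+ 2.
  by rewrite -real_normK ?num_real// lerXn2r ?nnegrE ?eucl_norm_ge0.
split.
  apply: le_trans (ramp_lipschitz _ _) _; rewrite normrM.
  have := ler_pM (normr_ge0 k) (normr_ge0 _) (lexx `|k|) hr.
  have := mulr_ge0 (sqr_ge0 k) (eucl_norm_ge0 h); lra.
apply: le_trans (ramp_second_diff _ _) _; rewrite exprMn.
have := ler_pM (sqr_ge0 k) (sqr_ge0 _) (lexx (k ^+ 2)) hr2.
have := mulr_ge0 (normr_ge0 k) (sqr_ge0 (eucl_norm h)); lra.
Qed.

Definition box (a b : 'rV[R]_n) : set 'rV[R]_n :=
  [set x | forall i, a ord0 i < x ord0 i < b ord0 i].

(** Positive exactly on the open box. The shapes [1 * _ + - _] and [- 1 * _ + _] are those expected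
    by [c11_ramp_coord]. *)
Definition bump (a b x : 'rV[R]_n) : R :=
  \prod_(i < n) (ramp (1 * x ord0 i + - a ord0 i) * ramp (- 1 * x ord0 i + b ord0 i)).

Lemma c11_bump a b : c11 (bump a b).
Proof. by apply: c11_prod => i; apply: c11M; exact: c11_ramp_coord. Qed.

Lemma bump_out a b x : ~ box a b x -> bump a b x = 0.
Proof.
move=> /existsNP[i /negP]; rewrite negb_and -!leNgt => xi.
rewrite /bump (bigD1 i)//=.
case/orP : xi => xi.
  by rewrite (@ramp_le0 _ (1 * _ - _)) ?mul0r//; lra.
by rewrite (@ramp_le0 _ (- 1 * _ + _)) ?(mul0r, mulr0)//; lra.
Qed.

Lemma bump_gt0 a b x : box a b x -> 0 < bump a b x.
Proof.
move=> abx; apply: prodr_gt0 => i _; have /andP[? ?] := abx i.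
by apply: mulr_gt0; apply: ramp_gt0; lra.
Qed.

Lemma c11_continuous phi : c11 phi -> continuous phi.
Proof.
move=> [_ _ [L L0 phiL]] x; apply/(@cvgrPdist_le _ _ _ (nbhs x)) => e e0.
near=> y.
rewrite distrC.
have [+ _] := phiL x (y - x); rewrite [x + _]addrC subrK => /le_trans; apply.
apply: (@le_trans _ _ ((L + 1) * (n%:R * `|y - x|))).
  by apply: ler_pM => //; rewrite ?eucl_norm_ge0 ?lerDl// eucl_norm_le_norm.
(* The continuity to be proved is for the sup norm, hence the factor [n%:R]; the two [+ 1] keep the
   denominator positive when [L] or [n] is 0. *)
have : `|y - x| <= e / ((L + 1) * (n%:R + 1)).
  rewrite distrC; near: y; apply: cvgr_dist_le; first exact: cvg_id.
  by rewrite divr_gt0// mulr_gt0// ltr_wpDl.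
rewrite ler_pdivlMr ?mulr_gt0 ?ltr_wpDl// => /(le_trans _); apply.
have := normr_ge0 (y - x); have : 0 <= n%:R :> R by []; nra.
Unshelve. all: by end_near. Qed.

End c11.

(** * Density of C^{1,1} functions *)

Section boxes.
Context {R : realType} {n : nat}.
Local Notation leb := (@lebesgue_rV R n).

Lemma measurable_box (a b : 'rV[R]_n) : measurable (box a b).
Proof.
have -> : box a b = bump a b @^-1` `]0, +oo[%classic.
  apply/seteqP; split => x /=; rewrite in_itv/= andbT; first exact: bump_gt0.
  by apply: contraPP => /bump_out ->; rewrite ltxx.
apply: measurable_preimage; last exact: measurable_itv.
by have [] := c11_bump a b.
Qed.

Lemma bounded_set_lebesgue_rV_lty (A : set 'rV[R]_n) :
  measurable A -> bounded_set A -> (leb A < +oo)%E.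
Proof.
move=> mA [M [_ HM]].
pose K := Num.max 0 M + 1.
have K0 : 0 <= K by rewrite addr_ge0// le_max lexx.
have AK x i : A x -> -K <= x ord0 i <= K.
  move=> Ax; rewrite -ler_norml; apply: le_trans (HM K _ x Ax).
    exact: ler_coord_norm.
  by rewrite /K (@le_lt_trans _ _ (Num.max 0 M)) ?le_max ?lexx ?orbT// ltrDl.
have -> : leb A = (\int[leb]_x (\1_A x)%:E)%E by rewrite integral_indic// setIT.
pose w : R -> R := \1_(`[- K, K]%classic).
have mw : measurable_fun setT w by exact: measurable_indic.
have w0 t : 0 <= w t by [].
apply: (@le_lt_trans _ _ (\int[leb]_x (\prod_(i < n) w (x ord0 i))%:E)%E).
  apply: ge0_le_integral => //.
  - by apply/measurable_EFinP; exact: measurable_indic.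
  - apply/measurable_EFinP; apply: measurable_prod => i _.
    by apply: (measurableT_comp mw); exact: measurable_rV_coord.
  - move=> x _; rewrite lee_fin indicE.
    case: (boolP (x \in A)) => [|_]; last exact: prodr_ge0.
    rewrite inE => Ax; rewrite big1// => i _; rewrite /w indicE mem_set//=.
    by rewrite in_itv/=; exact: AK.
rewrite (ge0_integral_prod_coord n mw)//.
rewrite integral_indic//= setIT lebesgue_measure_itv/=.
by case: ifP => _; rewrite -?EFinB -EFin_expe ltry.
Qed.

(** Pairs of rational corners are enumerated by [pickle], and a pair whose box leaves A is replaced
    by an empty box. Balls of the sup norm are cubes, so each point of A has a rational box around
    it inside A. *)
Lemma open_countable_boxes (A : set 'rV[R]_n) : (0 < n)%N -> open A ->
  exists a b : nat -> 'rV[R]_n,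
    (forall k, box (a k) (b k) `<=` A) /\ A = \bigcup_k box (a k) (b k).
Proof.
move=> n0 oA.
pose F (k : nat) : 'rV[R]_n * 'rV[R]_n :=
  if unpickle k is Some (p, q) then
    let a : 'rV[R]_n := map_mx ratr (p : 'rV[rat]_n) in
    let b : 'rV[R]_n := map_mx ratr (q : 'rV[rat]_n) in
    if `[< box a b `<=` A >] then (a, b) else (0, 0)
  else (0, 0).
(* This needs [0 < n]: in dimension 0 the condition defining a box is vacuous. *)
have F0 : box (0 : 'rV[R]_n) 0 = set0.
  apply/seteqP; split => // x /(_ (Ordinal n0)); rewrite mxE => /andP[h /(lt_trans h)].
  by rewrite ltxx.
have FA k : box (F k).1 (F k).2 `<=` A.
  rewrite /F; case: unpickle => [[p q]|]; last by rewrite F0.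
  by case: ifPn => [/asboolP//|_]; rewrite F0.
exists (fst \o F), (snd \o F); split => //.
apply/seteqP; split; last by move=> x [k _]; exact: FA.
move=> x Ax.
have /nbhs_ballP[e /= e0 eA] : nbhs x A by apply: open_nbhs_nbhs.
have /choice[p pP] i : exists r : rat, ratr r \in `]x ord0 i - e, x ord0 i[.
  by apply: rat_in_itvoo; lra.
have /choice[q qP] i : exists r : rat, ratr r \in `]x ord0 i, x ord0 i + e[.
  by apply: rat_in_itvoo; lra.
exists (pickle (\row_i p i : 'rV[rat]_n, \row_i q i : 'rV[rat]_n)) => //.
rewrite /= /F pickleK.
set a : 'rV[R]_n := map_mx _ _; set b : 'rV[R]_n := map_mx _ _.
have aE i : a ord0 i = ratr (p i) by rewrite !mxE.
have bE i : b ord0 i = ratr (q i) by rewrite !mxE.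
have abA : box a b `<=` A.
  move=> y yab; apply: eA; split => // i j; rewrite (ord1 i).
  have := yab j; have := pP j; have := qP j.
  by rewrite aE bE !in_itv/= /ball/= ltr_norml; lra.
case: ifPn => [_|/asboolP//] i /=.
by have := pP i; have := qP i; rewrite aE bE !in_itv/=; lra.
Qed.

Lemma open_measurable_rV (A : set 'rV[R]_n) : (0 < n)%N -> open A -> measurable A.
Proof.
move=> n0 /(open_countable_boxes n0)[a [b [_ ->]]].
by apply: bigcupT_measurable => k; exact: measurable_box.
Qed.

End boxes.

(** * Approximation of indicators in weighted L^1 *)

Section density.
Context {R : realType} {n : nat}.
Local Notation leb := (@lebesgue_rV R n).
Variable g : 'rV[R]_n -> R.
Hypotheses (ig : leb.-integrable setT (EFin \o g)) (g0 : forall x, 0 <= g x).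

Let mg : measurable_fun setT g.
Proof. apply/measurable_EFinP; exact: (measurable_int leb ig). Qed.

Let dist (u v : 'rV[R]_n -> R) : \bar R := (\int[leb]_x (g x * `|u x - v x|)%:E)%E.

Let measurable_dist (u v : 'rV[R]_n -> R) :
  measurable_fun setT u -> measurable_fun setT v ->
  measurable_fun setT (fun x => (g x * `|u x - v x|)%:E).
Proof.
move=> mu mv; apply/measurable_EFinP; apply: measurable_funM => //.
by apply: measurableT_comp => //; exact: measurable_funB.
Qed.

(** Two independent pairs on the right make this cover both the triangle inequality and the product
    estimate needed for intersections. *)
Let dist_triangle2 (u v u1 v1 u2 v2 : 'rV[R]_n -> R) :
  measurable_fun setT u1 -> measurable_fun setT v1 ->
  measurable_fun setT u2 -> measurable_fun setT v2 ->
  measurable_fun setT u -> measurable_fun setT v ->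
  (forall x, `|u x - v x| <= `|u1 x - v1 x| + `|u2 x - v2 x|) ->
  (dist u v <= dist u1 v1 + dist u2 v2)%E.
Proof.
move=> mu1 mv1 mu2 mv2 mu mv H; rewrite /dist -ge0_integralD//.
- apply: ge0_le_integral => //.
  + by move=> x _; rewrite lee_fin mulr_ge0.
  + exact: measurable_dist.
  + by apply: emeasurable_funD; exact: measurable_dist.
  + by move=> x _; rewrite -EFinD lee_fin -mulrDr ler_wpM2l.
- by move=> x _; rewrite lee_fin mulr_ge0.
- exact: measurable_dist.
- by move=> x _; rewrite lee_fin mulr_ge0.
- exact: measurable_dist.
Qed.

Let dist_cvg (u_ : nat -> 'rV[R]_n -> R) (u : 'rV[R]_n -> R) (e : R) :
  (forall k, measurable_fun setT (u_ k)) -> measurable_fun setT u ->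
  (forall k x, 0 <= u_ k x <= 1) -> (forall x, 0 <= u x <= 1) ->
  (forall x, u_ k x @[k --> \oo] --> u x) ->
  0 < e -> exists k, (dist u (u_ k) < e%:E)%E.
Proof.
move=> mu_ mu u_01 u01 cu e0.
have cv : {ae leb, forall x, setT x -> (g x * `|u x - u_ k x|)%:E @[k --> \oo] --> 0%E}.
  apply: aeW => x _; apply: cvg_EFin; first exact: nearW.
  rewrite -[X in _ --> X](mulr0 (g x)); apply: cvgMr.
  rewrite -[X in _ --> X](normr0 R) -(subrr (u x)).
  by apply: cvg_norm; apply: cvgB => //; exact: cvg_cst.
have bd : {ae leb, forall x k, setT x -> (`|(g x * `|u x - u_ k x|)%:E| <= (EFin \o g) x)%E}.
  apply: aeW => x k _; rewrite /= lee_fin normrM normr_id ger0_norm// ler_piMr//.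
  by rewrite ler_norml; have := u_01 k x; have := u01 x; lra.
have [_ _] := @dominated_convergence _ _ _ leb setT measurableT
  (fun k x => (g x * `|u x - u_ k x|)%:E) (cst 0%E) (EFin \o g)
  (fun k => measurable_dist mu (mu_ k)) (measurable_cst _) cv ig bd.
rewrite integral0 => /fine_cvgP[fnum /cvgr_lt/(_ e e0) lte].
have [k [fk lk]] := filter_ex (filterI fnum lte).
by exists k; rewrite -(@fineK _ (dist u (u_ k))) ?lte_fin.
Qed.

(** The sets whose indicator is a limit of C^{1,1} functions in L^1(g dx). They turn out to form a
    sigma-algebra; measurability is recorded in the definition because the distance estimates for
    intersections and unions need it. *)
Definition c11_approx (A : set 'rV[R]_n) : Prop := measurable A /\
  forall e : R, 0 < e -> exists2 phi, c11 phi & (dist \1_A phi < e%:E)%E.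

Lemma c11_approxC A : c11_approx A -> c11_approx (~` A).
Proof.
move=> [mA HA]; split; first exact: measurableC.
move=> e e0; have [phi cphi d] := HA e e0.
exists (fun x => 1 - phi x); first exact: c11_compl.
rewrite /dist; under eq_integral => x _.
  rewrite (_ : `|_ - _| = `|\1_A x - phi x|); first over.
  rewrite -normrN !indicE in_setC; congr `|_|; case: (x \in A) => /=; ring.
exact: d.
Qed.

Lemma c11_approxI A B : c11_approx A -> c11_approx B -> c11_approx (A `&` B).
Proof.
move=> [mA HA] [mB HB]; split; first exact: measurableI.
move=> e e0; have e20 : 0 < e / 2 by rewrite divr_gt0.
have [phi [mphi phi01 ?] dA] := HA _ e20; have [psi [mpsi psi01 ?] dB] := HB _ e20.
exists (fun x => phi x * psi x); first exact: c11M.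
apply: (@le_lt_trans _ _ (dist \1_A phi + dist \1_B psi)%E).
  apply: dist_triangle2 => //; try exact: measurable_indic.
  - exact/measurable_indic/measurableI.
  - exact: measurable_funM.
  - move=> x; rewrite indicI /=.
    have -> : \1_A x * \1_B x - phi x * psi x =
      (\1_A x - phi x) * \1_B x + phi x * (\1_B x - psi x) :> R by ring.
    apply: le_trans (ler_normD _ _) _; rewrite !normrM lerD//.
      by rewrite ler_piMr// indicE; case: (x \in B); rewrite ?normr0 ?normr1.
    by rewrite ler_piMl// ler_norml; have := phi01 x; lra.
by rewrite (splitr e) EFinD; exact: lteD.
Qed.

(** Finite unions come from complements and intersections by De Morgan's law. Their indicators
    converge pointwise to that of the countable union, hence in L^1(g dx) by domination by g, and
    half of the tolerance is spent on each approximation. *)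
Lemma c11_approx_bigcup (F : nat -> set 'rV[R]_n) :
  (forall k, c11_approx (F k)) -> c11_approx (\bigcup_k F k).
Proof.
move=> HF; split; first by apply: bigcupT_measurable => k; have [] := HF k.
move=> e e0; have e20 : 0 < e / 2 by rewrite divr_gt0.
have mF k : measurable (F k) by have [] := HF k.
pose G k := \big[setU/set0]_(i < k) F i.
have HG k : c11_approx (G k).
  rewrite /G; elim: k => [|k IH].
    rewrite big_ord0; split => // r r0; exists (cst 0); first by apply: c11_cst; lra.
    rewrite /dist; under eq_integral do rewrite indic0 /cst/= subrr normr0 mulr0.
    by rewrite integral0.
  rewrite big_ord_recr/= -[_ `|` _]setCK setCU.
  by apply/c11_approxC/c11_approxI; exact: c11_approxC.
have [k dk] : exists k, (dist \1_(\bigcup_k F k) \1_(G k) < (e / 2)%:E)%E.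
  apply: dist_cvg => //.
  - by move=> k; apply: measurable_indic; have [] := HG k.
  - exact/measurable_indic/bigcupT_measurable.
  - by move=> k x; rewrite indicE; case: (_ \in _); rewrite /= ?lexx ?ler01.
  - by move=> x; rewrite indicE; case: (_ \in _); rewrite /= ?lexx ?ler01.
  - move=> x; rewrite [X in _ --> X]indicE; case: (boolP (x \in _)) => [|xF].
      rewrite inE => -[j _ Fjx]; apply: cvg_near_cst.
      near=> k; rewrite indicE mem_set//; apply: (@bigsetU_sup _ j) => //.
      by near: k; exists j.+1.
    apply: cvg_near_cst; apply: nearW => k; rewrite indicE memNset//.
    move: xF; rewrite notin_setE; apply: contra_not.
    by rewrite /G -bigcup_mkord => -[j _ Fj]; exists j.
have [phi cphi dphi] := (HG k).2 _ e20.
exists phi => //.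
have [mphi _ _] := cphi.
apply: (@le_lt_trans _ _ (dist \1_(\bigcup_k F k) \1_(G k) + dist \1_(G k) phi)%E).
  have mG := (HG k).1.
  have mU := bigcupT_measurable F mF.
  apply: dist_triangle2 => //; try exact: measurable_indic.
  by move=> x; apply: ler_distD.
by rewrite (splitr e) EFinD; exact: lteD.
Unshelve. all: by end_near. Qed.

(** Ramps of slope proportional to k, starting from 0 at the hyperplane: they vanish on its closed
    lower side for every k, and at a point strictly above they equal 1 once k is large. *)
Lemma c11_approx_halfspace (i : 'I_n) (t : R) : 
  c11_approx [set x : 'rV[R]_n | t < x ord0 i].
Proof.
set H := [set x | _].
have mH : measurable H.
  have -> : H = rV_coord i @^-1` `]t, +oo[%classic.
    by apply/seteqP; split => x /=; rewrite in_itv/= andbT.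
  exact (measurable_preimage (@measurable_rV_coord _ (measurableTypeR R) n i)
    (measurable_itv _)).
split=> // e e0.
pose phi (k : nat) (x : 'rV[R]_n) := ramp (k%:R * x ord0 i + - (k%:R * t)).
have cphi k : c11 (phi k) by exact: c11_ramp_coord.
have [k dk] : exists k, (dist \1_H (phi k) < e%:E)%E.
  apply: dist_cvg => //.
  - by move=> k; have [] := cphi k.
  - by move=> k x; have [_ + _] := cphi k; apply.
  - by move=> x; rewrite indicE; case: (_ \in _); rewrite /= ?lexx ?ler01.
  - move=> x; apply: cvg_near_cst; rewrite indicE; case: (ltP t (x ord0 i)) => tx.
      rewrite mem_set//; near=> k; apply: ramp_ge1.
      rewrite -mulrBr -ler_pdivrMr ?subr_gt0//; near: k; exact: nbhs_infty_ger.
    rewrite memNset/=; last by apply/negP; rewrite -leNgt.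
    apply: nearW => k; apply: ramp_le0; rewrite -mulrBr.
    by rewrite mulr_ge0_le0// subr_le0.
by exists (phi k).
Unshelve. all: by end_near. Qed.

(** Two nested generation arguments: the sigma-algebra is generated by preimages of Borel sets under
    coordinates, and the Borel sets of the line by the rays []t, +oo[], whose preimages are
    half-spaces. *)
Lemma measurable_c11_approx A : measurable A -> c11_approx A.
Proof.
have sC B : c11_approx B -> c11_approx (setT `\` B) by rewrite setTD; exact: c11_approxC.
have s0 : c11_approx set0.
  split => // r r0; exists (cst 0); first by apply: c11_cst; lra.
  rewrite /dist; under eq_integral do rewrite indic0 /cst/= subrr normr0 mulr0.
  by rewrite integral0.
move: A; apply: smallest_sub; first by split => //; exact: c11_approx_bigcup.
rewrite -bigcup_seq => A [i _ [B mB <-]]; rewrite setTI.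
suff : @measurable _ (measurableTypeR R) `<=`
    [set B | c11_approx (@rV_coord _ (measurableTypeR R) n i @^-1` B)] by exact.
rewrite RGenOInfty.measurableE; apply: smallest_sub.
  split.
  - by rewrite /= preimage_set0.
  - by move=> C /= /sC; rewrite !setTD preimage_setC.
  - by move=> F HF /=; rewrite preimage_bigcup; exact: c11_approx_bigcup.
move=> _ [t ->] /=.
have -> : @rV_coord _ (measurableTypeR R) n i @^-1` `]t, +oo[ =
    [set x : 'rV[R]_n | t < x ord0 i];
  last exact: c11_approx_halfspace.
by apply/seteqP; split => x /=; rewrite in_itv/= andbT.
Qed.

End density.

(** * Construction of the test function *)

Section test_function.

Lemma integrable_mul_bounded d (T : measurableType d) (R : realType)
    (mu : {measure set T -> \bar R}) (D : set T) (g b : T -> R) (C : R) :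
  measurable D -> mu.-integrable D (EFin \o g) -> measurable_fun D b ->
  (forall x, D x -> `|b x| <= C) ->
  mu.-integrable D (EFin \o (fun x => g x * b x)).
Proof.
move=> mD ig mb bC.
have mg : measurable_fun D g by apply/measurable_EFinP; exact: measurable_int ig.
apply: (le_integrable mD _ _ (integrableZl mD `|C| (integrable_abse ig))).
  by apply/measurable_EFinP; exact: measurable_funM.
move=> x Dx; rewrite /= lee_fin !normrM !normr_id mulrC ler_wpM2r//.
by rewrite (le_trans (bC x Dx))// ler_norm.
Qed.

Context {R : realType} {n : nat}.
Local Notation leb := (@lebesgue_rV R n).

(** Some box of a countable cover of Omega meets {f > 0} in a set of positive measure, since
    otherwise f^+ would vanish almost everywhere. There the ideal choice chi^2 1_A, with A = {f > 0}
    and chi the bump of the box, makes the integral positive; replacing 1_A by a nearby C^{1,1}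
    function keeps it positive, while the factor chi keeps the support in the box. *)
Lemma exists_test_function (Omega : set 'rV[R]_n) (f : 'rV[R]_n -> R) :
  (0 < n)%N -> open Omega -> leb.-integrable setT (EFin \o (f \_ Omega)) ->
  ~ {ae leb, forall x, Omega x -> f^\+ x = 0} ->
  exists phi a b, [/\ c11 phi, box a b `<=` Omega,
    forall x, ~ box a b x -> phi x = 0 &
    0 < \int[leb]_x ((f \_ Omega) x * phi x ^+ 2)].
Proof.
move=> n0 oO; set h := f \_ Omega => ih fpos.
have [a [b [abO OE]]] := open_countable_boxes n0 oO.
have [k fk] : exists k, ~ {ae leb, forall x, box (a k) (b k) x -> f^\+ x = 0}.
  apply: contrapT => /forallNP H; apply: fpos.
  have /ae_foralln : forall k, {ae leb, forall x, box (a k) (b k) x -> f^\+ x = 0}.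
    by move=> k; apply: contrapT; exact: H.
  by apply: filterS => x Hx; rewrite OE => -[k _]; exact: Hx.
pose chi := bump (a k) (b k).
have [mchi chi01 _] : c11 chi := c11_bump (a k) (b k).
have mh : measurable_fun setT h by apply/measurable_EFinP; exact: (measurable_int leb ih).
pose A := h @^-1` `]0, +oo[%classic.
have mA : measurable A by apply: measurable_preimage => //; exact: measurable_itv.
pose F x := h x * (chi x ^+ 2 * \1_A x).
have mind : measurable_fun setT (\1_A : 'rV[R]_n -> R) by exact: measurable_indic.
have mchi2 : measurable_fun setT (fun x => chi x ^+ 2) by exact: measurable_funX.
have iF : leb.-integrable setT (EFin \o F).
  apply: (integrable_mul_bounded (C := 1)) => //; first exact: measurable_funM.
  move=> x _; have := chi01 x; rewrite indicE ler_norml.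
  by case: (x \in A); rewrite /=; nra.
have F0 x : 0 <= F x.
  rewrite /F indicE; case: (boolP (x \in A)) => [|_]; last by rewrite !mulr0.
  rewrite inE /A/= in_itv/= andbT mulr1 => hx.
  by rewrite mulr_ge0 ?sqr_ge0// ltW.
have I0 : 0 < \int[leb]_x F x.
  (* A nonnegative function of zero integral vanishes almost everywhere; as chi is positive on the
     box, f^+ would vanish there, against the choice of the box. *)
  rewrite lt_neqAle Rintegral_ge0// andbT; apply/eqP => I0; apply: fk.
  have : (\int[leb]_x (`|(F x)%:E|) = 0)%E.
    under eq_integral do rewrite gee0_abs ?lee_fin//.
    rewrite -(fineK (integrable_fin_num measurableT iF)).
    by move: I0; rewrite /Rintegral => <-.
  move=> /(@ae_eq_integral_abs _ _ _ leb setT measurableT (EFin \o F)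
    (measurable_int leb iF)).
  apply: filterS => x /(_ I)/= [Fx] xB.
  have Ox := abO k x xB.
  have hE : h x = f x by rewrite /h patchE mem_set.
  rewrite /funrpos; case: (leP (f x) 0) => [//|fx].
  move: Fx; rewrite /F indicE mem_set; last by rewrite /A/= hE in_itv/= andbT.
  rewrite /= mulr1 hE => /eqP; rewrite mulf_eq0 gt_eqF//= expf_eq0/=.
  by rewrite gt_eqF// bump_gt0.
set I := \int[leb]_x F x in I0.
have iah : leb.-integrable setT (EFin \o (fun x => `|h x|)).
  exact: integrable_norm.
(* The tolerance is I / 2 because replacing 1_A by eta^2 costs a factor 2: |1_A - eta^2| = |1_A -
   eta| |1_A + eta| <= 2 |1_A - eta|. *)
have [_ /(_ (I / 2))] := measurable_c11_approx iah (fun x => normr_ge0 _) mA.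
case; first by rewrite divr_gt0.
move=> eta ceta deta.
have [meta eta01 _] := ceta.
have iD : leb.-integrable setT (EFin \o (fun x => `|h x| * `|\1_A x - eta x|)).
  apply: (integrable_mul_bounded (C := 1)) => //.
    by apply: measurableT_comp => //; exact: measurable_funB.
  move=> x _; rewrite normr_id ler_norml; have := eta01 x.
  by rewrite indicE; case: (x \in A) => /=; lra.
have i2D : leb.-integrable setT (EFin \o (fun x => 2 * (`|h x| * `|\1_A x - eta x|))).
  by have := integrableZl measurableT 2 iD.
exists (fun x => chi x * eta x), (a k), (b k); split => //.
- by apply: c11M => //; exact: c11_bump.
- by move=> x /bump_out; rewrite -/(chi x) => ->; rewrite mul0r.
apply: (@lt_le_trans _ _ (\int[leb]_x (F x - 2 * (`|h x| * `|\1_A x - eta x|)))).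
  rewrite RintegralB// RintegralZl// subr_gt0 -/I mulrC -ltr_pdivlMr//.
  by rewrite -lte_fin fineK//; exact: (integrable_fin_num measurableT iD).
apply: le_Rintegral => //.
- by have := integrableB measurableT iF i2D.
- apply: (integrable_mul_bounded (C := 1)) => //.
    by apply: measurable_funX; exact: measurable_funM.
  move=> x _; have := chi01 x; have := eta01 x; rewrite ger0_norm ?sqr_ge0// => ? ?.
  by apply: exprn_ile1; nra.
- move=> x _; rewrite /F lerBlDr -lerBlDl -mulrBr.
  have -> : chi x ^+ 2 * \1_A x - (chi x * eta x) ^+ 2 =
    chi x ^+ 2 * ((\1_A x - eta x) * (\1_A x + eta x)) :> R.
    by rewrite indicE; case: (_ \in _) => /=; ring.
  apply: le_trans (ler_norm _) _; rewrite (normrM (h x)) (normrM (chi x ^+ 2)).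
  rewrite (normrM (\1_A x - eta x)) (mulrCA 2) ler_wpM2l//.
  have := chi01 x; have := eta01 x; have := normr_ge0 (\1_A x - eta x).
  move: (`|\1_A x - eta x|) => r r0 e01 c01.
  have c1 : `|chi x ^+ 2| <= 1 by rewrite ler_norml; nra.
  have e2 : `|\1_A x + eta x| <= 2.
    by rewrite ler_norml indicE; case: (x \in A) => /=; lra.
  have := ler_pM (normr_ge0 _) (mulr_ge0 r0 (normr_ge0 _)) c1 (ler_wpM2l r0 e2).
  by rewrite mul1r (mulrC r 2).
Qed.

End test_function.

(** * The fractional Laplacian of a C^{1,1} function *)

Lemma Rintegral_dominated_cvg d (T : measurableType d) (R : realType)
    (mu : {measure set T -> \bar R}) (f_ : nat -> T -> R) (f g : T -> R) :
  (forall k, measurable_fun setT (f_ k)) -> measurable_fun setT f ->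
  mu.-integrable setT (EFin \o g) ->
  (forall x, f_ k x @[k --> \oo] --> f x) ->
  (forall k x, `|f_ k x| <= g x) ->
  \int[mu]_x f_ k x @[k --> \oo] --> \int[mu]_x f x.
Proof.
move=> mf_ mf ig cf fg.
have mfE_ k : measurable_fun setT (EFin \o f_ k) by exact/measurable_EFinP.
have mfE : measurable_fun setT (EFin \o f) by exact/measurable_EFinP.
have cE : {ae mu, forall x, setT x -> (EFin \o f_ k) x @[k --> \oo] --> (EFin \o f) x}.
  by apply: aeW => x _; apply: cvg_EFin; [exact: nearW|exact: cf].
have bd : {ae mu, forall x k, setT x -> (`|(EFin \o f_ k) x| <= (EFin \o g) x)%E}.
  by apply: aeW => x k _; rewrite /= lee_fin.
have [i_f _] := @dominated_convergence _ _ _ mu setT measurableT _ _ _ mfE_ mfE cE ig bd.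
by rewrite -(fineK (integrable_fin_num measurableT i_f)) => /fine_cvg.
Qed.

Section fracLap_c11.
Context {R : realType} {n : nat}.
Local Notation leb := (@lebesgue_rV R n).
Variable s : R.
Hypotheses (n2 : (2 <= n)%N) (s12 : 1 / 2 < s < 1).

Lemma patchRE (T : Type) (f : T -> R) (D : set T) x :
  (f \_ D) x = if x \in D then f x else 0.
Proof. by rewrite patchE. Qed.

(** The usual weight of Lévy measures. It dominates, up to constants, the kernel away from the
    diagonal, the second-difference kernel, and the Gagliardo integrand of a bounded Lipschitz
    function. *)
Definition levy (z : 'rV[R]_n) : R :=
  Num.min 1 (eucl_norm z ^+ 2) / eucl_norm z `^ (n%:R + 2 * s).

Lemma levy_ge0 z : 0 <= levy z.
Proof. by rewrite /levy divr_ge0 ?powR_ge0// le_min ler01 sqr_ge0. Qed.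

Lemma measurable_levy : measurable_fun setT levy.
Proof. exact: measurable_levy_kernel. Qed.

Lemma measurable_levy_shift (x : 'rV[R]_n) : 
  measurable_fun setT (fun y : 'rV[R]_n => levy (x - y)).
Proof. exact: (measurableT_comp measurable_levy (measurable_reflect x)). Qed.

Lemma integral_levy_shift (x : 'rV[R]_n) :
  (\int[leb]_y (levy (x - y))%:E = \int[leb]_z (levy z)%:E)%E.
Proof.
apply: (@integral_reflect _ _ x (EFin \o levy)).
by apply/measurable_EFinP; exact: measurable_levy.
Qed.

Lemma integrable_levy_shift (x : 'rV[R]_n) :
  leb.-integrable setT (EFin \o (fun y => levy (x - y))).
Proof.
apply/integrableP; split; first by apply/measurable_EFinP; exact: measurable_levy_shift.
under eq_integral do rewrite /= ger0_norm ?levy_ge0//.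
by rewrite integral_levy_shift; exact: integral_levy_kernel_lty.
Qed.

Definition levyK : R := \int[leb]_z levy z.

Lemma levyK_shift x : \int[leb]_y levy (x - y) = levyK.
Proof. by rewrite /Rintegral integral_levy_shift. Qed.

Lemma Rintegral_reflect (c : 'rV[R]_n) (f : 'rV[R]_n -> R) : measurable_fun setT f ->
  \int[leb]_y f (c - y) = \int[leb]_y f y.
Proof.
move=> mf; rewrite /Rintegral (@integral_reflect _ _ c (EFin \o f))//.
exact/measurable_EFinP.
Qed.

Lemma integrable_reflect (c : 'rV[R]_n) (f : 'rV[R]_n -> R) :
  leb.-integrable setT (EFin \o f) -> leb.-integrable setT (EFin \o (fun y => f (c - y))).
Proof.
move=> /integrableP[mf fy]; have mf' : measurable_fun setT f by exact/measurable_EFinP.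
apply/integrableP; split.
  by apply/measurable_EFinP; exact: (measurableT_comp mf' (measurable_reflect c)).
rewrite (@integral_reflect _ _ c (abse \o (EFin \o f)))//.
exact: measurableT_comp.
Qed.

Lemma Rintegral_add_reflect (c : 'rV[R]_n) (f : 'rV[R]_n -> R) :
  leb.-integrable setT (EFin \o f) ->
  \int[leb]_y (f y + f (c - y)) = 2 * \int[leb]_y f y.
Proof.
move=> fi; have mf : measurable_fun setT f.
  by apply/measurable_EFinP; exact: (measurable_int leb fi).
rewrite (RintegralD measurableT fi (integrable_reflect c fi)) (Rintegral_reflect c mf).
by rewrite mulr_natl.
Qed.

Lemma integrable_patch (D : set 'rV[R]_n) (f : 'rV[R]_n -> R) : measurable D ->
  leb.-integrable D (EFin \o f) -> leb.-integrable setT (EFin \o (f \_ D)).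
Proof. by move=> mD; rewrite -restrict_EFin; apply: (integrable_mkcond _ mD).1. Qed.

(** On |z| >= e the numerator of [levy] is at least min(1, e^2). *)
Lemma le_kernel_levy (e C : R) (z : 'rV[R]_n) : 0 < e -> e <= eucl_norm z ->
  `|C| <= 1 -> `|C / eucl_norm z `^ (n%:R + 2 * s)| <= (Num.min 1 (e ^+ 2))^-1 * levy z.
Proof.
move=> e0 ez C1.
have m0 : 0 < Num.min 1 (e ^+ 2) by rewrite lt_min ltr01 exprn_gt0.
rewrite normrM normrV ?unitfE ?gt_eqF ?powR_gt0 ?(lt_le_trans e0)//.
rewrite (ger0_norm (powR_ge0 _ _)) /levy mulrA ler_wpM2r ?invr_ge0 ?powR_ge0//.
rewrite (le_trans C1)// mulrC ler_pdivlMr// mul1r le_min !ge_min lexx/=.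
by rewrite (lerXn2r 2 (ltW e0) (eucl_norm_ge0 z) ez) orbT.
Qed.

Variable psi : 'rV[R]_n -> R.
Hypothesis cpsi : c11 psi.

Let mpsi : measurable_fun setT psi. Proof. by case: cpsi. Qed.
Let psi01 x : 0 <= psi x <= 1. Proof. by have [_ + _] := cpsi; exact. Qed.

Local Notation ker := (fracLap_kernel s psi).
Local Notation far x e := [set y : 'rV[R]_n | e <= eucl_norm (x - y)].

Lemma measurable_far x e : measurable (far x e).
Proof.
have -> : far x e = (fun y => eucl_norm (x - y)) @^-1` `[e, +oo[%classic.
  by apply/seteqP; split => y /=; rewrite in_itv/= andbT.
apply: measurable_preimage; last exact: measurable_itv.
exact: (measurableT_comp (@measurable_eucl_norm R n) (measurable_reflect x)).
Qed.

Lemma measurable_kernel x : measurable_fun setT (ker x).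
Proof.
apply: measurable_funM; first exact: measurable_funB.
under eq_fun do rewrite -powRN.
apply: (measurableT_comp (measurable_powR _)).
exact: (measurableT_comp (@measurable_eucl_norm R n) (measurable_reflect x)).
Qed.

Lemma integrable_kernel_far x e : 0 < e ->
  leb.-integrable (far x e) (EFin \o ker x).
Proof.
move=> e0; have mD := measurable_far x e.
have := integrableZl mD (Num.min 1 (e ^+ 2))^-1
  (integrableS measurableT mD (@subsetT _ _) (integrable_levy_shift x)).
apply: le_integrable => //.
  by apply/measurable_EFinP/measurable_funTS; exact: measurable_kernel.
move=> y /= ey; rewrite lee_fin (le_trans (le_kernel_levy e0 ey _)) ?ler_norm//.
by rewrite ler_norml; have := psi01 x; have := psi01 y; lra.
Qed.

(** The kernel at y plus the kernel at x + x - y, the mirror image of y in x. The first differences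
    combine into a second difference, of order |x - y|^2, which restores integrability at the
    diagonal. *)
Let sym x y : R :=
  (2 * psi x - psi y - psi (x + x - y)) / eucl_norm (x - y) `^ (n%:R + 2 * s).

Let measurable_sym x : measurable_fun setT (sym x).
Proof.
apply: measurable_funM.
  apply: measurable_funB; first exact: measurable_funB.
  exact: (measurableT_comp mpsi (measurable_reflect _)).
under eq_fun do rewrite -powRN.
apply: (measurableT_comp (measurable_powR _)).
exact: (measurableT_comp (@measurable_eucl_norm R n) (measurable_reflect x)).
Qed.

Let sym_le : exists2 L : R, 0 <= L & forall x y, `|sym x y| <= L * levy (x - y).
Proof.
have [_ _ [L L0 HL]] := cpsi.
exists (L + 2) => [|x y]; first by rewrite addr_ge0.
rewrite /sym /levy normrM mulrA.
rewrite (@ger0_norm _ (_ `^ _)^-1) ?invr_ge0 ?powR_ge0// ler_wpM2r ?invr_ge0 ?powR_ge0//.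
have [_ +] := HL x (x - y); rewrite opprB addrA (addrC x (y - x)) subrK => H.
have {}H : `|2 * psi x - psi y - psi (x + x - y)| <= L * eucl_norm (x - y) ^+ 2.
  by rewrite -normrN (_ : - (_ - _ - _) = psi (x + x - y) + psi y - 2 * psi x)//; ring.
have H2 : `|2 * psi x - psi y - psi (x + x - y)| <= 2.
  by rewrite ler_norml; have := psi01 x; have := psi01 y; have := psi01 (x + x - y); lra.
have := sqr_ge0 (eucl_norm (x - y)).
by case: (leP 1 (eucl_norm (x - y) ^+ 2)); nra.
Qed.

Let integrable_sym x : leb.-integrable setT (EFin \o sym x).
Proof.
have [L L0 HL] := sym_le.
apply: (le_integrable measurableT _ _ (integrableZl measurableT L (integrable_levy_shift x))).
  by apply/measurable_EFinP; exact: measurable_sym.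
by move=> y _; rewrite /= lee_fin (le_trans (HL x y))// ler_norm.
Qed.

Let fracLap_truncE x e : 0 < e ->
  fracLap_trunc s psi x e = 2^-1 * \int[leb]_y (sym x \_ (far x e)) y.
Proof.
move=> e0; rewrite /fracLap_trunc Rintegral_mkcond.
set g := ker x \_ (far x e).
have ig : leb.-integrable setT (EFin \o g).
  apply: integrable_patch; [exact: measurable_far|exact: integrable_kernel_far].
have -> : \int[leb]_y (sym x \_ (far x e)) y = \int[leb]_y (g y + g (x + x - y)).
  apply: eq_Rintegral => y _; rewrite /g !patchRE.
  have E : eucl_norm (x - (x + x - y)) = eucl_norm (x - y).
    rewrite [LHS]eucl_norm_distC; congr eucl_norm.
    by apply/rowP => i; rewrite !mxE; ring.
  have -> : (x + x - y \in far x e) = (y \in far x e) by apply/idP/idP; rewrite !inE/= E.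
  case: (y \in far x e); last by rewrite addr0.
  by rewrite /sym /fracLap_kernel E -mulrDl; congr (_ / _); ring.
by rewrite (Rintegral_add_reflect (x + x) ig) mulrA mulVf// mul1r.
Qed.

Let integrable_sym_far x e : leb.-integrable setT (EFin \o (sym x \_ (far x e))).
Proof.
have mD := measurable_far x e.
apply: integrable_patch => //.
exact: (integrableS measurableT mD (@subsetT _ _) (integrable_sym x)).
Qed.

(** Uniformity in both x and e is the point: it later provides the majorant C |u| when e tends to 0
    under an integral in x. The integral of [levy (x - y)] in y does not depend on x, and the [+ 1]
    makes the constant positive. *)
Lemma fracLap_trunc_bounded : exists2 C : R, 0 < C &
  forall x e, 0 < e -> `|fracLap_trunc s psi x e| <= C.
Proof.
have [L L0 HL] := sym_le.
have K0 : 0 <= levyK by apply: Rintegral_ge0 => z _; exact: levy_ge0.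
exists (L * levyK + 1) => [|x e e0]; first by rewrite ltr_wpDl// mulr_ge0.
rewrite fracLap_truncE//.
have : `|\int[leb]_y (sym x \_ (far x e)) y| <= L * levyK.
  apply: le_trans (le_normr_Rintegral _ (integrable_sym_far x e)) _ => //.
  rewrite -(levyK_shift x) -RintegralZl//; last exact: integrable_levy_shift.
  apply: le_Rintegral => //.
  - exact: (integrable_norm (integrable_sym_far x e)).
  - exact: (integrableZl measurableT L (integrable_levy_shift x)).
  - move=> y _; rewrite patchRE; case: (y \in _); first exact: HL.
    by rewrite normr0 mulr_ge0// levy_ge0.
rewrite normrM (@ger0_norm _ 2^-1)//; have := normr_ge0 (\int[leb]_y (sym x \_ (far x e)) y).
lra.
Qed.

Lemma fracLap_trunc_cvg x :
  fracLap_trunc s psi x e @[e --> 0^'+] --> 2^-1 * \int[leb]_y sym x y.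
Proof.
apply/cvg_at_rightP => u [u0 cu].
under eq_fun do rewrite fracLap_truncE//.
apply: cvgMr.
have [L L0 HL] := sym_le.
apply: (@Rintegral_dominated_cvg _ _ _ leb (fun k => sym x \_ (far x (u k))) (sym x)
  (fun y => L * levy (x - y))).
- move=> k; apply/measurable_EFinP; exact: (measurable_int leb (integrable_sym_far x (u k))).
- exact: measurable_sym.
- exact: (integrableZl measurableT L (integrable_levy_shift x)).
- move=> y; apply: cvg_near_cst.
  have [->|xy] := eqVneq y x.
    (* The point y = x lies outside every truncated domain, so convergence there rests on the value
       of [sym x x], which is 0 because the inverse of 0 is 0. *)
    have s0 : sym x x = 0.
      rewrite /sym subrr (_ : eucl_norm 0 = 0) ?powR0 ?invr0 ?mulr0//.
      - by apply/eqP; move/andP : s12 => [? ?]; have : 0 <= n%:R :> R by []; lra.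
      - by rewrite /eucl_norm big1 ?sqrtr0// => i _; rewrite mxE expr0n.
    by apply: nearW => k; rewrite patchRE s0; case: (x \in _).
  have xy0 : 0 < eucl_norm (x - y) by rewrite eucl_norm_gt0// subr_eq0 eq_sym.
  near=> k; rewrite patchRE mem_set//=.
  by near: k; exact: (cvgr_le _ cu).
- move=> k y; rewrite patchRE; case: (y \in _); first exact: HL.
  by rewrite normr0 mulr_ge0// levy_ge0.
Unshelve. all: by end_near. Qed.

Lemma fracLap_exists_c11 x : fracLap_exists s psi x.
Proof.
split; first by move=> e e0; exact: integrable_kernel_far.
by apply/cvg_ex; eexists; exact: fracLap_trunc_cvg.
Qed.

Lemma cvg_fracLap_c11 x :
  fracLap_trunc s psi x e @[e --> 0^'+] --> fracLap s psi x.
Proof. by have [_] := fracLap_exists_c11 x. Qed.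

Lemma fracLap_c11_bounded : exists2 C : R, 0 < C & forall x, `|fracLap s psi x| <= C.
Proof.
have [C C0 HC] := fracLap_trunc_bounded.
exists C => // x; rewrite -(cvg_lim _ (cvg_norm (@cvg_fracLap_c11 x)))//.
apply: limr_le; first by apply/cvg_ex; eexists; exact: cvg_norm (@cvg_fracLap_c11 x).
by near=> e; apply: HC; near: e; exact: nbhs_right_gt.
Unshelve. all: by end_near. Qed.

End fracLap_c11.

(** * The energy inequality *)

Lemma integrable_indic_lty d (T : measurableType d) (R : realType)
    (mu : {measure set T -> \bar R}) (A : set T) :
  measurable A -> (mu A < +oo)%E -> mu.-integrable setT (EFin \o (\1_A : T -> R)).
Proof.
move=> mA Alty.
apply/integrableP; split; first by apply/measurable_EFinP; exact: measurable_indic.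
by under eq_integral do rewrite /= ger0_norm//; rewrite integral_indic// setIT.
Qed.

Section product_swap.
Context d (T : measurableType d) (R : realType).
Variable m : {sigma_finite_measure set T -> \bar R}.
Variable f : T * T -> R.
Hypothesis fi : (m \x m)%E.-integrable setT (EFin \o f).

Let mf : measurable_fun setT (EFin \o f). Proof. exact: measurable_int fi. Qed.

Let mfs : measurable_fun setT (EFin \o (f \o @swap T T)).
Proof. apply: (measurableT_comp mf); exact: measurable_swap. Qed.

Lemma integrable_swap : (m \x m)%E.-integrable setT (EFin \o (f \o @swap T T)).
Proof.
by apply/(integrable21ltyP _ _ mfs); exact: (integrable12ltyP m m mf).1 fi.
Qed.

Lemma Rintegral_swap : \int[(m \x m)%E]_z f (swap z) = \int[(m \x m)%E]_z f z.
Proof.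
rewrite /Rintegral; congr fine.
rewrite -(integral21_prod_meas1 fi) -(integral12_prod_meas1 integrable_swap).
by [].
Qed.

End product_swap.

Section energy.
Context {R : realType} {n : nat}.
Local Notation leb := (@lebesgue_rV R n).
Local Notation leb2 := (leb \x leb)%E.
Variable s : R.
Hypotheses (n2 : (2 <= n)%N) (s12 : 1 / 2 < s < 1).

Lemma measurable_pair_sub : measurable_fun setT (fun z : 'rV[R]_n * 'rV[R]_n => z.1 - z.2).
Proof.
apply/measurable_fun_rVP => i; under eq_fun do rewrite !mxE.
by apply: measurable_funB;
  apply: (measurableT_comp (@measurable_rV_coord _ (measurableTypeR R) n i)).
Qed.

Definition gker (z : 'rV[R]_n * 'rV[R]_n) : R :=
  (eucl_norm (z.1 - z.2) `^ (n%:R + 2 * s))^-1.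

Lemma gker_ge0 z : 0 <= gker z.
Proof. by rewrite invr_ge0 powR_ge0. Qed.

Lemma gker_swap z : gker (swap z) = gker z.
Proof. by rewrite /gker /= eucl_norm_distC. Qed.

Lemma measurable_gker : measurable_fun setT gker.
Proof.
rewrite /gker; under eq_fun do rewrite -powRN.
apply: (measurableT_comp (measurable_powR _)).
exact: (measurableT_comp (@measurable_eucl_norm R n) measurable_pair_sub).
Qed.

Lemma levy_distC (x y : 'rV[R]_n) : levy s (x - y) = levy s (y - x).
Proof. by rewrite /levy eucl_norm_distC. Qed.

(** By Tonelli, the inner integral in y is the constant [levyK] times g(x). It is used with g an
    indicator for the seminorm of phi, and with g = |u| for the truncated energy. *)
Lemma integrable_levy_prod (g : 'rV[R]_n -> R) :
  leb.-integrable setT (EFin \o g) -> (forall x, 0 <= g x) ->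
  leb2.-integrable setT (EFin \o (fun z => g z.1 * levy s (z.1 - z.2))).
Proof.
move=> ig g0.
have mg : measurable_fun setT g by apply/measurable_EFinP; exact: (measurable_int leb ig).
pose F (z : 'rV[R]_n * 'rV[R]_n) := g z.1 * levy s (z.1 - z.2).
have mF : measurable_fun setT (EFin \o F).
  apply/measurable_EFinP; apply: measurable_funM.
    exact: (measurableT_comp mg).
  exact: (measurableT_comp (measurable_levy s) measurable_pair_sub).
apply/(integrable12ltyP _ _ mF).
have E x : (\int[leb]_y `|(EFin \o F) (x, y)| =
    (levyK (n := n) s * g x)%:E)%E.
  transitivity (\int[leb]_y ((g x)%:E * (levy s (x - y))%:E))%E.
    apply: eq_integral => y _ /=; rewrite -EFinM; congr (_%:E).
    by rewrite ger0_norm// mulr_ge0// levy_ge0.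
  rewrite ge0_integralZl_EFin//; last 2 first.
  - by move=> y _; rewrite lee_fin levy_ge0.
  - by apply/measurable_EFinP; exact: measurable_levy_shift.
  rewrite mulrC EFinM; congr (_ * _)%E; rewrite integral_levy_shift /levyK /Rintegral fineK//.
  rewrite ge0_fin_numE ?integral_levy_kernel_lty// integral_ge0// => z _.
  by rewrite lee_fin levy_ge0.
under eq_integral do rewrite E.
have := integrableZl measurableT (levyK (n := n) s) ig.
by move=> /integrable_lty => /(_ measurableT).
Qed.

Variables (phi : 'rV[R]_n -> R) (B : set 'rV[R]_n).
Hypotheses (cphi : c11 phi) (mB : measurable B) (Blty : (leb B < +oo)%E)
  (phiB : forall x, ~ B x -> phi x = 0).

Let mphi : measurable_fun setT phi. Proof. by case: cphi. Qed.
Let phi01 x : 0 <= phi x <= 1. Proof. by have [_ + _] := cphi; exact. Qed.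

Let mphi1 : measurable_fun setT (fun z : 'rV[R]_n * 'rV[R]_n => phi z.1).
Proof. exact: (measurableT_comp mphi). Qed.
Let mphi2 : measurable_fun setT (fun z : 'rV[R]_n * 'rV[R]_n => phi z.2).
Proof. exact: (measurableT_comp mphi). Qed.

Definition gagl (z : 'rV[R]_n * 'rV[R]_n) : R := (phi z.1 - phi z.2) ^+ 2 * gker z.

Lemma gagl_ge0 z : 0 <= gagl z.
Proof. exact: mulr_ge0 (sqr_ge0 _) (gker_ge0 z). Qed.

(** The integrand vanishes unless x or y lies in B, and the bounds |phi(x) - phi(y)| <= min(1, L |x
    - y|) give the majorant (L^2 + 1) (1_B(x) + 1_B(y)) [levy (x - y)]. *)
Lemma integrable_gagl : leb2.-integrable setT (EFin \o gagl).
Proof.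
have [_ _ [L L0 HL]] := cphi.
have iB := integrable_indic_lty mB Blty.
have B0 x : 0 <= (\1_B x : R) by [].
have i1 := integrable_levy_prod iB B0.
have i2 := integrable_swap i1.
have i12 := integrableZl measurableT (L ^+ 2 + 1) (integrableD measurableT i1 i2).
apply: (le_integrable measurableT _ _ i12).
  apply/measurable_EFinP; apply: measurable_funM; last exact: measurable_gker.
  by apply: measurable_funX; exact: measurable_funB.
move=> -[x y] _ /=; rewrite lee_fin (ger0_norm (gagl_ge0 _)).
apply: le_trans (ler_norm _).
rewrite (levy_distC y x) -mulrDl /gagl /gker /levy/= !mulrA ler_wpM2r ?invr_ge0 ?powR_ge0//.
have lip : (phi x - phi y) ^+ 2 <= L ^+ 2 * eucl_norm (x - y) ^+ 2.
  have [+ _] := HL y (x - y); rewrite [y + _]addrC subrK ler_norml.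
  have := mulr_ge0 L0 (eucl_norm_ge0 (x - y)); rewrite -exprMn; nra.
have one : (phi x - phi y) ^+ 2 <= 1.
  by have := phi01 x; have := phi01 y; nra.
have m0 : 0 <= Num.min 1 (eucl_norm (x - y) ^+ 2) by rewrite le_min ler01 sqr_ge0.
have key : (phi x - phi y) ^+ 2 <= (L ^+ 2 + 1) * Num.min 1 (eucl_norm (x - y) ^+ 2).
  have := sqr_ge0 (eucl_norm (x - y)); have := sqr_ge0 L.
  by case: (leP 1 (eucl_norm (x - y) ^+ 2)); nra.
rewrite !indicE; case: (boolP (x \in B)) => xB; last first.
  case: (boolP (y \in B)) => yB; last first.
    move: xB yB; rewrite !notin_setE => /phiB -> /phiB ->.
    by rewrite subrr expr0n addr0 mulr0 mul0r.
  by rewrite add0r mulr1.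
apply: le_trans key _; apply: ler_wpM2r => //.
by rewrite ler_peMr ?lerDl// addr_ge0 ?sqr_ge0.
Qed.

Variable u : 'rV[R]_n -> R.
Hypotheses (ui : leb.-integrable setT (EFin \o u)).

Let mu : measurable_fun setT u.
Proof. by apply/measurable_EFinP; exact: (measurable_int leb ui). Qed.
Let mu1 : measurable_fun setT (fun z : 'rV[R]_n * 'rV[R]_n => u z.1).
Proof. exact: (measurableT_comp mu). Qed.
Let mu2 : measurable_fun setT (fun z : 'rV[R]_n * 'rV[R]_n => u z.2).
Proof. exact: (measurableT_comp mu). Qed.

Let psi x := phi x ^+ 2.
Let cpsi : c11 psi. Proof. exact: c11M. Qed.

Let A : \bar R := (\int[leb]_x (Ds2 s u x * (psi x)%:E))%E.
Hypothesis Alty : (A < +oo)%E.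

(** The weight sits at the first point only, so that integrating in the second variable yields
    D_s^2(u) times psi; the weight at the second point is recovered through [swap]. *)
Let P (z : 'rV[R]_n * 'rV[R]_n) : R := (u z.1 - u z.2) ^+ 2 * psi z.1 * gker z.

Let P_ge0 z : 0 <= P z.
Proof. by apply: mulr_ge0 (gker_ge0 z); apply: mulr_ge0; exact: sqr_ge0. Qed.

Let mP : measurable_fun setT P.
Proof.
apply: measurable_funM; last exact: measurable_gker.
apply: measurable_funM; apply: measurable_funX => //; exact: measurable_funB.
Qed.

Let PE x : (\int[leb]_y (P (x, y))%:E = Ds2 s u x * (psi x)%:E)%E.
Proof.
rewrite muleC /Ds2 -ge0_integralZl_EFin//.
- apply: eq_integral => y _; rewrite -EFinM; congr (_%:E).
  by rewrite /P /gker/= real_normK ?num_real// mulrAC mulrC.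
- by move=> y _; rewrite lee_fin divr_ge0 ?powR_ge0// exprn_ge0.
- apply/measurable_EFinP; apply: measurable_funM.
    apply: measurable_funX; apply: measurableT_comp => //; exact: measurable_funB.
  exact: (measurableT_comp measurable_gker (@measurable_pair1 _ _ _ _ x)).
- exact: sqr_ge0.
Qed.

Let Pi : leb2.-integrable setT (EFin \o P).
Proof.
have mPE : measurable_fun setT (EFin \o P) by exact/measurable_EFinP.
apply/(integrable12ltyP _ _ mPE).
rewrite [ltLHS](_ : _ = A)//; apply: eq_integral => x _; rewrite -PE.
by apply: eq_integral => y _ /=; rewrite ger0_norm.
Qed.

Let RP : \int[leb2]_z P z = fine A.
Proof.
rewrite /Rintegral -(integral12_prod_meas1 Pi); congr fine.
by apply: eq_integral => x _; rewrite -PE.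
Qed.

(** The truncation is written as a factor, so that it is part of a single function on the product
    space. With it, u in L^1 alone gives absolute integrability, hence Fubini's theorem and the
    exchange of variables. *)
Let H (e : R) (z : 'rV[R]_n * 'rV[R]_n) : R :=
  u z.1 * ((psi z.1 - psi z.2) / eucl_norm (z.1 - z.2) `^ (n%:R + 2 * s)) *
  (e <= eucl_norm (z.1 - z.2))%R%:R.

Let Hi e : 0 < e -> leb2.-integrable setT (EFin \o H e).
Proof.
move=> e0.
have := integrable_levy_prod (integrable_norm ui) (fun x => normr_ge0 (u x)).
move=> /(integrableZl measurableT (Num.min 1 (e ^+ 2))^-1); apply: le_integrable => //.
  apply/measurable_EFinP; apply: measurable_funM.
    apply: measurable_funM => //; apply: measurable_funM; last exact: measurable_gker.
    by apply: measurable_funB; exact: measurable_funX.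
  pose D := (fun z : 'rV[R]_n * 'rV[R]_n => eucl_norm (z.1 - z.2)) @^-1` `[e, +oo[%classic.
  rewrite (_ : (fun z => _) = \1_D); last first.
    apply/funext => z; rewrite indicE.
    suff -> : (z \in D) = (e <= eucl_norm (z.1 - z.2))%R by [].
    by apply/idP/idP; rewrite inE /D/= in_itv/= andbT.
  apply: measurable_indic; apply: measurable_preimage; last exact: measurable_itv.
  exact: (measurableT_comp (@measurable_eucl_norm R n) measurable_pair_sub).
move=> -[x y] _ /=; rewrite lee_fin; apply: le_trans (ler_norm _).
rewrite /H/= -mulrA normrM mulrCA; apply: ler_wpM2l => //.
case: (leP e (eucl_norm (x - y))) => exy; last first.
  by rewrite mulr0 normr0 mulr_ge0 ?levy_ge0// invr_ge0 le_min ler01 sqr_ge0.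
rewrite mulr1; apply: le_kernel_levy => //.
have [_ psi01 _] := cpsi.
by rewrite ler_norml; have := psi01 x; have := psi01 y; lra.
Qed.

Let HE e x : 0 < e ->
  (\int[leb]_y (H e (x, y))%:E = (u x * fracLap_trunc s psi x e)%:E)%E.
Proof.
move=> e0; pose far := [set y | e <= eucl_norm (x - y)].
have mD := measurable_far x e.
have ki := integrable_patch mD (integrable_kernel_far n2 s12 cpsi x e0).
transitivity (\int[leb]_y (u x * (fracLap_kernel s psi x \_ far) y)%:E)%E.
  apply: eq_integral => y _; rewrite patchRE /H/=; congr (_%:E).
  rewrite -mulrA; congr (_ * _).
  have -> : (y \in far) = (e <= eucl_norm (x - y)) by apply/idP/idP; rewrite inE.
  by case: (e <= _); rewrite ?mulr1 ?mulr0.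
have ki' := integrableZl measurableT (u x) ki.
rewrite /fracLap_trunc Rintegral_mkcond -RintegralZl//.
by rewrite -[LHS]fineK//; exact: (integrable_fin_num measurableT ki').
Qed.

Let measurable_u_trunc e : 0 < e ->
  measurable_fun setT (fun x => u x * fracLap_trunc s psi x e).
Proof.
move=> e0; apply/measurable_EFinP.
have := measurable_fubini_F (Hi e0).
by congr (measurable_fun _ _); apply/funext => x; rewrite /fubini_F HE.
Qed.

Let RH e : 0 < e ->
  \int[leb]_x (u x * fracLap_trunc s psi x e) = \int[leb2]_z H e z.
Proof.
move=> e0; rewrite /Rintegral -(integral12_prod_meas1 (Hi e0)); congr fine.
by apply: eq_integral => x _; rewrite -HE.
Qed.

(* Young: [d a (a - b) <= c d^2 a^2 + (a - b)^2 / (4 c)], and likewise with [b]. *)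
Let young (c d a b : R) : 0 < c ->
  d * (a ^+ 2 - b ^+ 2) <= c * (d ^+ 2 * (a ^+ 2 + b ^+ 2)) + (2 * c)^-1 * (a - b) ^+ 2.
Proof.
move=> c0.
have : 0 <= c^-1 * ((2 * c * d * a - (a - b)) ^+ 2 + (2 * c * d * b - (a - b)) ^+ 2).
  apply: mulr_ge0; first by rewrite invr_ge0 ltW.
  by apply: addr_ge0; exact: sqr_ge0.
have -> : c^-1 * ((2 * c * d * a - (a - b)) ^+ 2 + (2 * c * d * b - (a - b)) ^+ 2) =
  4 * (c * (d ^+ 2 * (a ^+ 2 + b ^+ 2)) + (2 * c)^-1 * (a - b) ^+ 2 - d * (a ^+ 2 - b ^+ 2)).
  by field; rewrite gt_eqF.
lra.
Qed.

(** Adding the swapped integrand doubles the integral and replaces u(x) by u(x) - u(y). Young's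
    inequality then gives 2 c A + (2 c)^-1 G, where A and G are the weighted energy and the integral
    of [gagl]; halving produces (4 c)^-1. *)
Let H_le (c e : R) : 0 < c -> 0 < e ->
  \int[leb2]_z H e z <= c * fine A + (4 * c)^-1 * \int[leb2]_z gagl z.
Proof.
move=> c0 e0.
have hi := Hi e0; have his := integrable_swap hi; have pis := integrable_swap Pi.
have gi := integrable_gagl.
have pi2 : leb2.-integrable setT (EFin \o (fun z => P z + P (swap z))).
  exact: (integrableD measurableT Pi pis).
have ppi : leb2.-integrable setT (EFin \o (fun z => c * (P z + P (swap z)))).
  exact: (integrableZl measurableT c pi2).
have ggi : leb2.-integrable setT (EFin \o (fun z => (2 * c)^-1 * gagl z)).
  exact: (integrableZl measurableT (2 * c)^-1 gi).
have : \int[leb2]_z (H e z + H e (swap z)) <=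
    \int[leb2]_z (c * (P z + P (swap z)) + (2 * c)^-1 * gagl z).
  apply: (le_Rintegral measurableT (integrableD measurableT hi his)
    (integrableD measurableT ppi ggi)).
  move=> -[x y] _ /=.
  have := gker_ge0 (x, y).
  rewrite /P gker_swap /H /gagl /= (eucl_norm_distC y x) -/(gker (x, y)).
  have := young (u x - u y) (phi x) (phi y) c0.
  rewrite /psi; move: (u x) (u y) (phi x) (phi y) (gker (x, y)) => a b p q k Y k0.
  (* Off the truncated domain the left side is 0 while the right side is nonnegative, so the bound
     is free of e. *)
  case: (e <= _)%R => /=; rewrite ?mulr0 ?mulr1 ?addr0.
    have := ler_wpM2r k0 Y; lra.
  rewrite addr_ge0// mulr_ge0//; first exact: ltW.
  - by rewrite -mulrDl mulr_ge0// addr_ge0// mulr_ge0 ?sqr_ge0.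
  - by rewrite invr_ge0 mulr_ge0// ltW.
  - by rewrite mulr_ge0 ?sqr_ge0.
have -> : \int[leb2]_z (H e z + H e (swap z)) = \int[leb2]_z H e z + \int[leb2]_z H e z.
  by rewrite -[X in _ = _ + X](Rintegral_swap hi); exact: (RintegralD measurableT hi his).
have -> : \int[leb2]_z (c * (P z + P (swap z)) + (2 * c)^-1 * gagl z) =
    c * (fine A + fine A) + (2 * c)^-1 * \int[leb2]_z gagl z.
  transitivity (\int[leb2]_z (c * (P z + P (swap z))) + \int[leb2]_z ((2 * c)^-1 * gagl z)).
    exact: (RintegralD measurableT ppi ggi).
  congr (_ + _); last exact: (RintegralZl _ measurableT gi).
  transitivity (c * \int[leb2]_z (P z + P (swap z))).
    exact: (RintegralZl _ measurableT pi2).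
  congr (_ * _); rewrite -[X in _ = X + _]RP -RP -[X in _ = _ + X](Rintegral_swap Pi).
  exact: (RintegralD measurableT Pi pis).
move: (fine A) (\int[leb2]_z H e z) (\int[leb2]_z gagl z) => a h g.
have -> : (4 * c)^-1 = (2 * c)^-1 / 2 by field; rewrite gt_eqF.
lra.
Qed.

Let eps (k : nat) : R := k.+1%:R^-1.
Let eps_gt0 k : 0 < eps k. Proof. by rewrite invr_gt0. Qed.

Let cvg_trunc x : u x * fracLap_trunc s psi x (eps k) @[k --> \oo] --> u x * fracLap s psi x.
Proof.
apply: cvgMr; have /cvg_at_rightP := @cvg_fracLap_c11 _ _ _ n2 s12 _ cpsi x.
by apply; split => //; exact: cvg_harmonic.
Qed.

(** Each truncated product is measurable in x as an inner Fubini integral, and this is their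
    pointwise limit. *)
Lemma measurable_u_fracLap : measurable_fun setT (fun x => u x * fracLap s psi x).
Proof.
apply: (measurable_fun_cvg (fun k => measurable_u_trunc (eps_gt0 k))) => x _.
exact: cvg_trunc.
Qed.

(** The bound on truncated integrals is independent of the truncation, and dominated convergence
    with majorant C |u| carries it to the limit. *)
Lemma energy_inequality (c : R) : 0 < c ->
  \int[leb]_x (u x * fracLap s psi x) <=
  c * fine (\int[leb]_x (Ds2 s u x * (psi x)%:E))%E +
  (4 * c)^-1 * \int[leb2]_z gagl z.
Proof.
move=> c0.
have [C C0 HC] := fracLap_trunc_bounded n2 s12 cpsi.
have cv : \int[leb]_x (u x * fracLap_trunc s psi x (eps k)) @[k --> \oo] -->
    \int[leb]_x (u x * fracLap s psi x).
  apply: (@Rintegral_dominated_cvg _ _ _ leb (fun k x => u x * fracLap_trunc s psi x (eps k))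
    _ (fun x => C * `|u x|)).
  - by move=> k; exact: measurable_u_trunc.
  - exact: measurable_u_fracLap.
  - exact: (integrableZl measurableT C (integrable_norm ui)).
  - exact: cvg_trunc.
  - by move=> k x; rewrite normrM mulrC ler_wpM2r// HC.
rewrite -(cvg_lim _ cv)//; apply: limr_le; first by apply/cvg_ex; eexists; exact: cv.
by apply: nearW => k; rewrite RH//; exact: H_le.
Qed.

End energy.

(** * Nonexistence *)

Section Lp.

Lemma Lfun_measurable d (T : measurableType d) (R : realType)
    (mu : {measure set T -> \bar R}) (p : \bar R) (f : T -> R) :
  f \in Lfun mu p -> measurable_fun setT f.
Proof. by rewrite inE => /andP[+ _]; rewrite inE. Qed.

Lemma Lfun_infty_bounded d (T : measurableType d) (R : realType)
    (mu : {measure set T -> \bar R}) (f : T -> R) :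
  f \in Lfun mu +oo%E -> exists M : R, {ae mu, forall x, `|f x| <= M}.
Proof.
rewrite inE => /andP[_]; rewrite inE/= /finite_norm unlock.
case: ifPn => [_|]; first exact: (@ess_supr_bounded _ _ _ mu (fun x => `|f x|)).
(* When the whole space is null, any bound holds almost everywhere. *)
by rewrite -leNgt measure_le0 => /eqP T0 _; exists 0; exact: measure0_ae.
Qed.

Context {R : realType} {n : nat}.
Local Notation leb := (@lebesgue_rV R n).

(** For a finite exponent r, |f| <= 1 + |f|^r, and the constant 1 is integrable on Omega by
    finiteness of its measure; for an infinite exponent the essential bound plays the same role. *)
Lemma Lp_on_integrable (Omega : set 'rV[R]_n) (p : \bar R) (f : 'rV[R]_n -> R) :
  measurable Omega -> (leb Omega < +oo)%E -> (1 < p)%E -> Lp_on Omega p f ->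
  leb.-integrable setT (EFin \o (f \_ Omega)).
Proof.
move=> mO Olty p1 Lf.
have mh := Lfun_measurable Lf.
have mhE : measurable_fun setT (EFin \o (f \_ Omega)) by exact/measurable_EFinP.
have i1 := integrable_indic_lty mO Olty.
case: p p1 Lf => [r r1 Lf|_ Lf|//].
  have ir := Lfun_integrable (ltW r1) Lf.
  apply: (le_integrable measurableT mhE _ (integrableD measurableT i1 ir)).
  move=> x _ /=; rewrite lee_fin; apply: le_trans (ler_norm _).
  rewrite indicE patchRE; case: (x \in Omega) => /=; last first.
    by rewrite normr0 addr_ge0// powR_ge0.
  case: (leP `|f x| 1) => fx.
    by rewrite (le_trans fx)// lerDl powR_ge0.
  rewrite (le_trans (le1r_powR (ltW fx) (ltW r1)))// lerDr//.
have [M HM] := Lfun_infty_bounded Lf.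
have iM := integrableZl measurableT `|M| i1.
apply/integrableP; split => //.
apply: le_lt_trans (integrable_lty measurableT iM).
apply: ae_ge0_le_integral => //.
- exact: measurableT_comp.
- by move=> x _; rewrite /= lee_fin mulr_ge0.
- exact: (measurable_int leb iM).
- apply: filterS HM => x Hx _ /=; rewrite lee_fin indicE.
  move: Hx; rewrite patchRE; case: (x \in Omega) => /= Hx; last by rewrite normr0 mulr0.
  by rewrite mulr1 (le_trans Hx)// ler_norm.
Qed.

End Lp.

Lemma measurable_fun_patch_on d (T : measurableType d) (R : realType) (D : set T)
    (f : T -> R) :
  measurable D -> measurable_fun setT (f \_ D) -> measurable_fun D f.
Proof. by move=> mD mf; apply/(measurable_restrictT f mD). Qed.

Lemma integral_ae0_out d (T : measurableType d) (R : realType)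
    (mu : {measure set T -> \bar R}) (D : set T) (f : T -> R) :
  measurable D -> measurable_fun setT f -> {ae mu, forall x, ~ D x -> f x = 0} ->
  (\int[mu]_(x in D) (f x)%:E = \int[mu]_x (f x)%:E)%E.
Proof.
move=> mD mf f0; rewrite integral_mkcond; apply: ae_eq_integral => //.
- rewrite restrict_EFin; apply/measurable_EFinP/(measurable_restrictT f mD).
  exact: measurable_funTS.
- exact/measurable_EFinP.
- apply: filterS f0 => x fx _; rewrite restrict_EFin/= patchRE.
  case: (boolP (x \in D)) => //; rewrite notin_setE => /fx -> //.
Qed.

Lemma integrable_ae0_out d (T : measurableType d) (R : realType)
    (mu : {measure set T -> \bar R}) (D : set T) (f : T -> R) :
  measurable D -> measurable_fun setT f -> {ae mu, forall x, ~ D x -> f x = 0} ->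
  mu.-integrable D (EFin \o f) -> mu.-integrable setT (EFin \o f).
Proof.
move=> mD mf f0 /integrableP[_ fi]; apply/integrableP; split; first exact/measurable_EFinP.
under eq_integral do rewrite /=.
rewrite -(@integral_ae0_out _ _ _ mu D (fun x => `|f x|))//.
- exact: measurableT_comp.
- by apply: filterS f0 => x + xD => /(_ xD) ->; rewrite normr0.
Qed.

Lemma integrable_fine d (T : measurableType d) (R : realType)
    (mu : {measure set T -> \bar R}) (D : set T) (g : T -> \bar R) :
  measurable D -> mu.-integrable D g -> mu.-integrable D (EFin \o (fine \o g)).
Proof.
move=> mD ig; have mg := measurable_int mu ig.
apply: (le_integrable mD _ _ ig).
  by apply/measurable_EFinP; apply: measurableT_comp => //; exact: fine_measurable.
by move=> x _ /=; case: (g x) => [r||] //=; rewrite ?normr0 ?leey.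
Qed.

(** The weak formulation integrates extended reals, with [g] possibly infinite on a null set and
    [mu] bounded only almost everywhere. Clamping [mu] between [mu1] and [M] and taking [fine] of
    [g] changes the integrand on a null set and makes every term a real integrable function. *)
Lemma weak_rhs_ge d (T : measurableType d) (R : realType)
    (nu : {measure set T -> \bar R}) (D : set T) (g : T -> \bar R)
    (mu f psi : T -> R) (mu1 M lambda : R) :
  measurable D -> nu.-integrable D g -> (forall x, 0 <= g x)%E ->
  measurable_fun D mu -> nu.-integrable D (EFin \o f) ->
  {ae nu, forall x, D x -> mu1 <= mu x} -> {ae nu, forall x, D x -> mu x <= M} ->
  measurable_fun D psi -> (forall x, 0 <= psi x <= 1) ->
  mu1 * \int[nu]_(x in D) (fine (g x) * psi x) + lambda * \int[nu]_(x in D) (f x * psi x) <=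
  fine (\int[nu]_(x in D) (((mu x)%:E * g x + (lambda * f x)%:E) * (psi x)%:E))%E.
Proof.
move=> mD ig g0 mmu fi mu_ge mu_le mpsi psi01.
have iv := integrable_fine mD ig.
have mg := measurable_int nu ig.
have mf : measurable_fun D f by apply/measurable_EFinP; exact: (measurable_int nu fi).
have psi1 x : D x -> `|psi x| <= 1 by move=> _; rewrite ler_norml; have := psi01 x; lra.
pose mu' x := Num.max mu1 (Num.min (mu x) M).
have mmu' : measurable_fun D mu' by apply: measurable_maxr => //; exact: measurable_minr.
have mu'_bd x : D x -> `|mu' x| <= `|mu1| + `|M|.
  move=> _; rewrite /mu' maxEle minEle; have := normr_ge0 mu1; have := normr_ge0 M.
  have := ler_norm mu1; have := ler_norm M; have := lerNnormlW (lexx `|mu1|).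
  rewrite ler_norml; case: ifP; case: ifP; lra.
have i1 := integrable_mul_bounded mD (integrable_mul_bounded mD iv mmu' mu'_bd) mpsi psi1.
have i2 := integrable_mul_bounded mD fi mpsi psi1.
have i2' : nu.-integrable D (EFin \o (fun x => lambda * (f x * psi x))).
  exact: (integrableZl mD lambda i2).
have i3 := integrable_mul_bounded mD iv mpsi psi1.
have i3' : nu.-integrable D (EFin \o (fun x => mu1 * (fine (g x) * psi x))).
  exact: (integrableZl mD mu1 i3).
have -> : (\int[nu]_(x in D) (((mu x)%:E * g x + (lambda * f x)%:E) * (psi x)%:E))%E =
    (\int[nu]_(x in D) (fine (g x) * mu' x * psi x + lambda * (f x * psi x))%:E)%E.
  apply: ae_eq_integral => //.
  - apply: emeasurable_funM; last exact/measurable_EFinP.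
    apply: emeasurable_funD.
      by apply: emeasurable_funM => //; exact/measurable_EFinP.
    by apply/measurable_EFinP; apply: measurable_funM.
  - exact: (measurable_int nu (integrableD mD i1 i2')).
  - have gfin := integrable_ae mD ig.
    near=> x => Dx.
    have gx : g x \is a fin_num by apply: (near gfin x).
    have m1 : mu1 <= mu x by apply: (near mu_ge x).
    have m2 : mu x <= M by apply: (near mu_le x).
    have -> : mu' x = mu x by rewrite /mu' min_l// max_r.
    rewrite -[in LHS](fineK gx); move: (fine (g x)) => v.
    transitivity (((mu x * v + lambda * f x) * psi x)%:E); first by [].
    by congr (_%:E); ring.
have -> : mu1 * \int[nu]_(x in D) (fine (g x) * psi x) +
    lambda * \int[nu]_(x in D) (f x * psi x) =
    \int[nu]_(x in D) (mu1 * (fine (g x) * psi x) + lambda * (f x * psi x)).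
  rewrite -(RintegralZl mu1 mD i3) -(RintegralZl lambda mD i2).
  by rewrite -(RintegralD mD i3' i2').
apply: (le_Rintegral mD (integrableD mD i3' i2') (integrableD mD i1 i2')) => x Dx.
rewrite lerD2r mulrA ler_wpM2r//; first by case/andP : (psi01 x).
by rewrite mulrC ler_wpM2l ?fine_ge0// /mu' le_max lexx.
Unshelve. all: by end_near. Qed.

Lemma test_space_c11 (R : realType) n (Omega : set 'rV[R]_n) (s : R) psi :
  (2 <= n)%N -> 1 / 2 < s < 1 -> c11 psi -> (forall x, ~ Omega x -> psi x = 0) ->
  test_space Omega s psi.
Proof.
move=> n2 s12 cpsi psi0; split.
- exact: c11_continuous.
- apply: closure_subset => x /= /eqP psix; apply: contrapT => /psi0; exact: psix.
- by move=> x _; exact: fracLap_exists_c11.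
- by have [C C0 HC] := fracLap_c11_bounded n2 s12 cpsi; exists C.
Qed.

Theorem theorem1p2 (R : realType) (N : nat) (Omega : set 'rV[R]_N) (s : R)
    (m : \bar R) (f mu : 'rV[R]_N -> R) (mu1 : R)
    (hN : (2 <= N)%N)
    (hOmega : bounded_C2_domain Omega)
    (hs : 1 / 2 < s < 1)
    (hm : ((N%:R / (2 * s))%:E < m)%E)
    (hf : Lp_on Omega m f)
    (hmu : Lp_on Omega +oo%E mu)
    (hmu1 : 0 < mu1)
    (hmu_ge : {ae @lebesgue_rV R N, forall x, Omega x -> mu1 <= mu x})
    (hfpos : ~ {ae @lebesgue_rV R N, forall x, Omega x -> f^\+ x = 0}) :
  exists lambda0 : R, 0 < lambda0 /\
    forall lambda : R, lambda0 < lambda ->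
      ~ exists u : 'rV[R]_N -> R,
          weak_solution Omega s mu f lambda u /\ W0_sp Omega s 2 u.
Proof.
have [oO _ _ bO _] := hOmega.
have N0 : (0 < N)%N by exact: ltn_trans hN.
have mO := open_measurable_rV N0 oO.
have Olty := bounded_set_lebesgue_rV_lty mO bO.
(* N >= 2 and s < 1 give N / (2 s) >= 1; with Omega of finite measure, f is then integrable on
   Omega. *)
have m1 : (1 < m)%E.
  apply: le_lt_trans hm; rewrite lee_fin.
  have : 2 <= N%:R :> R by rewrite ler_nat.
  by move/andP : hs => [s1 s2] ?; rewrite ler_pdivlMr; lra.
have ih := Lp_on_integrable mO Olty m1 hf.
have [phi [a [b [cphi abO phi0 J0]]]] := exists_test_function N0 oO ih hfpos.
pose psi x := phi x ^+ 2.
have cpsi : c11 psi by exact: c11M.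
have [mpsi psi01 _] := cpsi.
have psi0 x : ~ Omega x -> psi x = 0.
  by move=> Ox; rewrite /psi phi0 ?expr0n//; apply: contra_not Ox; exact: abO.
set J := (\int[_]_x _) in J0.
have JE : J = \int[lebesgue_rV N]_(x in Omega) (f x * psi x).
  rewrite Rintegral_mkcond; apply: eq_Rintegral => x _.
  by rewrite !patchRE; case: (x \in Omega) => //; rewrite mul0r.
pose C := \int[(lebesgue_rV N \x lebesgue_rV N)%E]_z gagl s phi z.
have C0 : 0 <= C by apply: Rintegral_ge0 => z _; exact: gagl_ge0.
(* The final inequality reads lambda J <= C / (4 mu1); adding 1 makes the threshold positive
   whatever C >= 0 is. *)
exists ((4 * mu1)^-1 * C / J + 1); split.
  have mu4 : 0 <= (4 * mu1)^-1 by rewrite invr_ge0 mulr_ge0// ltW.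
  by rewrite ltr_wpDl// mulr_ge0 ?mulr_ge0// invr_ge0 ltW.
move=> lambda hl [u [[iu iD u0 weak] [[Lu _] _]]].
have mu_ := Lfun_measurable Lu.
(* The energy inequality lives on the whole space: u is measurable there as an element of L^2 and
   vanishes almost everywhere outside Omega. *)
have iuT := integrable_ae0_out mO mu_ u0 iu.
have [M HM] := Lfun_infty_bounded hmu.
have D0 x : (0 <= Ds2 s u x)%E.
  by apply: integral_ge0 => y _; rewrite lee_fin divr_ge0 ?powR_ge0// exprn_ge0.
have iv := integrable_fine mO iD.
have psi1 x : Omega x -> `|psi x| <= 1 by move=> _; rewrite ler_norml; have := psi01 x; lra.
have ivp := integrable_mul_bounded mO iv (measurable_funTS mpsi) psi1.
have AE : (\int[lebesgue_rV N]_x (Ds2 s u x * (psi x)%:E) =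
    \int[lebesgue_rV N]_(x in Omega) (fine (Ds2 s u x) * psi x)%:E)%E.
  transitivity (\int[lebesgue_rV N]_(x in Omega) (Ds2 s u x * (psi x)%:E))%E.
    (* Outside Omega [Ds2 s u x] may be infinite, but its product with psi(x) = 0 is 0. *)
    rewrite [RHS]integral_mkcond; apply: eq_integral => x _; rewrite patchE.
    by case: ifPn => //; rewrite notin_setE => /psi0 ->; rewrite mule0.
  apply: ae_eq_integral => //.
  - apply: emeasurable_funM; first exact: (measurable_int (lebesgue_rV N) iD).
    by apply/measurable_EFinP; exact: measurable_funTS.
  - exact: (measurable_int (lebesgue_rV N) ivp).
  - apply: filterS (integrable_ae mO iD) => x Dx Ox.
    by rewrite -{1}(fineK (Dx Ox)).
have Alty : (\int[lebesgue_rV N]_x (Ds2 s u x * (psi x)%:E) < +oo)%E.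
  by rewrite AE; exact: integrable_lty ivp.
have boxlty : (lebesgue_rV N (box a b) < +oo)%E.
  by apply: le_lt_trans Olty; apply: le_measure => //; rewrite inE//; exact: measurable_box.
have en := energy_inequality hN hs cphi (measurable_box a b) boxlty phi0 iuT Alty hmu1.
have mw : measurable_fun setT (fun x => u x * fracLap s psi x).
  exact (measurable_u_fracLap hN hs cphi iuT).
have if' : (lebesgue_rV N).-integrable Omega (EFin \o f).
  by apply/(integrable_mkcond _ mO); rewrite restrict_EFin.
have mmu : measurable_fun Omega mu.
  by apply: (measurable_fun_patch_on mO); exact: Lfun_measurable hmu.
have mu_le : {ae lebesgue_rV N, forall x, Omega x -> mu x <= M}.
  apply: filterS HM => x + Ox; rewrite patchRE mem_set//; exact: le_trans (ler_norm _).
have rhs := weak_rhs_ge lambda mO iD D0 mmu if' hmu_ge mu_le (measurable_funTS mpsi) psi01.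
have := weak psi (test_space_c11 hN hs cpsi psi0).
have E : (\int[lebesgue_rV N]_(x in Omega) (u x * fracLap s psi x)%:E =
    \int[lebesgue_rV N]_x (u x * fracLap s psi x)%:E)%E.
  apply: integral_ae0_out => //.
  by apply: filterS u0 => x + Ox => /(_ Ox) ->; rewrite mul0r.
rewrite E => /(congr1 fine) => wk.
move: rhs; rewrite -wk -/(Rintegral _ _ _) -JE => rhs.
(* With c = [mu1] both sides carry the same term, and it is a real number because D_s^2(u) is
   integrable on Omega, so it cancels. *)
have := le_trans rhs en; rewrite AE -/(Rintegral _ _ _) lerD2l -/C.
have : (4 * mu1)^-1 * C < lambda * J.
  by rewrite -ltr_pdivrMr//; apply: lt_trans hl; rewrite ltrDl.
by move=> h /(lt_le_trans h); rewrite ltxx.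
Qed.
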